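(* Let $n\ge1$ and $\Sigma=\{\sigma\}$. In the subposet of $\Pi_{n,\{\sigma\}}$ of type $B_n$, $C_n$ or $D_n$, equipped with the restriction of the labeling $\lambda$, the number of maximal decreasing chains from $\hat0$ to the element $[n]_\sigma$ (the partition with the single block $[[n]]$, signed by $\sigma$) equals $$\sum_{\pi=\pi_1\mid\cdots\mid\pi_k\in\Pi_n} f(\pi)\,(2|\pi_1|-3)!!\cdots(2|\pi_k|-3)!!,$$ where $k$ is the number of blocks of $\pi$, $s$ is the number of blocks of $\pi$ with at least two elements, and $f(\pi)=k!$ in type $B_n=C_n$, $f(\pi)=s\cdot(k-1)!$ in type $D_n$.
   Context: $[n]=\{1,\dots,n\}$, $[[n]]=\{1,\bar1,\dots,n,\bar n\}$ with involution $i\leftrightarrow\bar i$, $\bar X=\{\bar x:x\in X\}$. For a finite set $\Sigma$, a $\Sigma$-labeled partition of $[[n]]$: a set partition $\pi$ of $[[n]]$ with a set $T\subseteq\pi$ of signed blocks and an injection $f:T\to\Sigma$, such that each block $R$ has $\bar R$ also a block, and $S=\bar S$ iff $S$ is signed. $\Sigma(\pi)=f(T)$, $\pi_\sigma$ = block of sign $\sigma$ ($\emptyset$ if none). Order: $\pi\preceq\psi$ iff $\pi_\sigma\subseteq\psi_\sigma$ for all $\sigma\in\Sigma(\pi)$ and each unsigned block $R$ of $\pi$ has a block $T$ of $\psi$ with $R\subseteq T$, $\bar R\subseteq\bar T$. $\Pi_{n,\Sigma}$: all such partitions plus a new maximum $\hat1$; $\hat0$ = partition into singletons. With $\Sigma=\{\sigma\}$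 (taken as the distinguished sign), type $B_n$ and type $C_n$ subposets both equal $\Pi_{n,\{\sigma\}}$, and type $D_n$ consists of $\hat1$ and all $x\neq\hat1$ with $|x_\sigma|\ne2$. Labeling $\lambda$ of covers $x\prec\!\cdot\,y$: $r(R)$ = least $i\in[n]$ with $i$ or $\bar i$ in $R$; $R$ normalized if $r(R)\in R$. If $y\ne\hat1$: coherent cover ($R\cup R'\in y$ for distinct normalized unsigned blocks $R,R'$ of $x$): $(0,\max(r(R),r(R')))$; non-coherent ($R\cup\bar{R'}\in y$): $(2,\min(r(R),r(R')))$; edge of sign $\sigma$ ($x_\sigma\subsetneq y_\sigma$): $(1,|\{\tau\in\Sigma(x):\tau\le\sigma\}|)$ if $\sigma\in\Sigma(x)$, else $(1,|\{\tau\in\Sigma:\tau\le\sigma\}\cup\Sigma(x)|)$; and $\lambda(x\prec\!\cdot\,\hat1)=(1,2)$. Labels ordered lexicographically; a chain is decreasing if its labels, read upwards, weakly decrease. $\Pi_n$ = set partitions of $[n]$. Convention $(-1)!!=1$. *)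

(* Defs.v *)
From HB Require Import structures.
From mathcomp Require Import all_boot all_order all_algebra.
Set Implicit Arguments.
Unset Strict Implicit.
Unset Printing Implicit Defensive.
Import Order.TTheory.

(* The pair (i, false) stands for the element i + 1 of [[n]], and (i, true)   *)
(* for its barred copy.                                                       *)
Definition dbl (n : nat) := ('I_n * bool)%type.
HB.instance Definition _ (n : nat) := Finite.on (dbl n).

Definition bar (n : nat) (x : dbl n) : dbl n := (x.1, ~~ x.2).

Definition barset (n : nat) (R : {set dbl n}) : {set dbl n} :=
  [set bar x | x in R].

(* The first component of d is the set partition. The second encodes the      *)
(* injection f : T -> Sigma as a partial function on sets, T being the set of *)
(* the S with d.2 S != None.                                                  *)
Definition lpart_axiom (n : nat) (Sigma : finType)
    (d : {set {set dbl n}} * {ffun {set dbl n} -> option Sigma}) : bool :=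
  [&& partition d.1 [set: dbl n],
      [forall R in d.1, barset R \in d.1],
      [forall S, (d.2 S != None) ==> (S \in d.1)],
      [forall S, forall S', (d.2 S != None) && (d.2 S == d.2 S') ==> (S == S')]
    & [forall S in d.1, (S == barset S) == (d.2 S != None)]].

Record lpart (n : nat) (Sigma : finType) := LPart {
  lpart_data : {set {set dbl n}} * {ffun {set dbl n} -> option Sigma};
  lpart_dataP : lpart_axiom lpart_data }.

HB.instance Definition _ (n : nat) (Sigma : finType) :=
  [isSub for @lpart_data n Sigma].
HB.instance Definition _ (n : nat) (Sigma : finType) :=
  [Finite of lpart n Sigma by <:].

Definition blocks (n : nat) (Sigma : finType) (x : lpart n Sigma) :
  {set {set dbl n}} := (lpart_data x).1.

Definition sgn (n : nat) (Sigma : finType) (x : lpart n Sigma)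
  (R : {set dbl n}) : option Sigma := (lpart_data x).2 R.

Definition unsigned (n : nat) (Sigma : finType) (x : lpart n Sigma)
  (R : {set dbl n}) : bool := (R \in blocks x) && (sgn x R == None).

Definition signs (n : nat) (Sigma : finType) (x : lpart n Sigma) :
  {set Sigma} := [set s | [exists R, sgn x R == Some s]].

Definition sblock (n : nat) (Sigma : finType) (x : lpart n Sigma)
  (s : Sigma) : {set dbl n} := odflt set0 [pick R | sgn x R == Some s].

Definition lpart_le (n : nat) (Sigma : finType) (x y : lpart n Sigma) : bool :=
  [forall s in signs x, sblock x s \subset sblock y s] &&
  [forall R, unsigned x R ==>
     [exists T in blocks y, (R \subset T) && (barset R \subset barset T)]].

(* None is the added maximum.                                                 *)
Definition lposet (n : nat) (Sigma : finType) := option (lpart n Sigma).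
HB.instance Definition _ (n : nat) (Sigma : finType) :=
  Finite.on (lposet n Sigma).

Definition lposet_le (n : nat) (Sigma : finType) (x y : lposet n Sigma) :
    bool :=
  match x, y with
  | _, None => true
  | None, Some _ => false
  | Some p, Some q => lpart_le p q
  end.

Lemma barsetS (n : nat) (R T : {set dbl n}) :
  R \subset T -> barset R \subset barset T.
Proof. exact: imsetS. Qed.

Lemma blocks_partition (n : nat) (Sigma : finType) (x : lpart n Sigma) :
  partition (blocks x) [set: dbl n].
Proof. by have /and5P[] := lpart_dataP x. Qed.

Lemma sgn_block (n : nat) (Sigma : finType) (x : lpart n Sigma) R s :
  sgn x R = Some s -> R \in blocks x.
Proof.
have /and5P[_ _ /forallP/(_ R) H _ _] := lpart_dataP x; rewrite /sgn => E.
by move: H; rewrite E.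
Qed.

Lemma sgn_inj (n : nat) (Sigma : finType) (x : lpart n Sigma) R T s :
  sgn x R = Some s -> sgn x T = Some s -> R = T.
Proof.
have /and5P[_ _ _ /forallP/(_ R)/forallP/(_ T) H _] := lpart_dataP x.
rewrite /sgn => E E'; apply/eqP; move: H; rewrite E E' /=.
by rewrite eqxx.
Qed.

Lemma sgn_sblock (n : nat) (Sigma : finType) (x : lpart n Sigma) R s :
  sgn x R = Some s -> sblock x s = R.
Proof.
move=> E; rewrite /sblock; case: pickP => [T /eqP ET|/(_ R)] /=.
  exact: sgn_inj ET E.
by rewrite E eqxx.
Qed.

Lemma block_neq0 (n : nat) (Sigma : finType) (x : lpart n Sigma) R :
  R \in blocks x -> R != set0.
Proof.
move=> xR; have /and3P[_ _ x0] := blocks_partition x.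
by apply: contraNneq x0 => <-.
Qed.

Lemma in_signsP (n : nat) (Sigma : finType) (x : lpart n Sigma) s :
  reflect (sgn x (sblock x s) = Some s) (s \in signs x).
Proof.
rewrite inE; apply: (iffP existsP) => [[R /eqP E]|E]; last first.
  by exists (sblock x s); apply/eqP.
by rewrite (sgn_sblock E).
Qed.

Lemma in_signs_neq0 (n : nat) (Sigma : finType) (x : lpart n Sigma) s :
  (s \in signs x) = (sblock x s != set0).
Proof.
apply/idP/idP => [/in_signsP/sgn_block/block_neq0 //|].
rewrite /sblock; case: pickP => [R E _|]; last by rewrite /= eqxx.
by rewrite inE; apply/existsP; exists R.
Qed.

Lemma lpart_leP (n : nat) (Sigma : finType) (x y : lpart n Sigma) :
  reflect ((forall s, sblock x s \subset sblock y s) /\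
           forall R, R \in blocks x -> exists2 T, T \in blocks y & R \subset T)
          (lpart_le x y).
Proof.
apply: (iffP andP) => [[/forallP Hs /forallP Hu]|[Hs Hu]]; last first.
  split; first by apply/forallP => s; apply/implyP; rewrite Hs.
  apply/forallP => R; apply/implyP; case/andP=> /Hu[T yT RT] _; apply/existsP; exists T.
  by rewrite yT RT barsetS.
have Hs' s : sblock x s \subset sblock y s.
  case: (boolP (s \in signs x)) (Hs s) => [_ //|].
  by rewrite in_signs_neq0 negbK => /eqP->; rewrite sub0set.
split=> // R xR; case E: (sgn x R) => [s|].
  exists (sblock y s); last by rewrite -(sgn_sblock E).
  apply/sgn_block/in_signsP; rewrite in_signs_neq0 -subset0.
  apply: contraNN (block_neq0 xR) => y0; rewrite -subset0 -(sgn_sblock E).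
  exact: subset_trans (Hs' s) y0.
have := Hu R; rewrite /unsigned xR E /= => /existsP[T /and3P[yT RT _]].
by exists T.
Qed.

Lemma lpart_le_refl (n : nat) (Sigma : finType) :
  reflexive (@lpart_le n Sigma).
Proof. by move=> x; apply/lpart_leP; split=> // R; exists R. Qed.

Lemma lpart_le_trans (n : nat) (Sigma : finType) :
  transitive (@lpart_le n Sigma).
Proof.
move=> y x z /lpart_leP[xys xyb] /lpart_leP[yzs yzb]; apply/lpart_leP; split.
  by move=> s; apply: subset_trans (xys s) (yzs s).
move=> R /xyb[T /yzb[U zU TU] RT]; exists U => //.
exact: subset_trans RT TU.
Qed.

Lemma lpart_le_anti (n : nat) (Sigma : finType) :
  antisymmetric (@lpart_le n Sigma).
Proof.
move=> x y /andP[/lpart_leP[xys xyb] /lpart_leP[yxs yxb]].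
have sub (u v : lpart n Sigma) :
    (forall R, R \in blocks u -> exists2 T, T \in blocks v & R \subset T) ->
    (forall R, R \in blocks v -> exists2 T, T \in blocks u & R \subset T) ->
    blocks u \subset blocks v.
  move=> uv vu; apply/subsetP => R uR.
  have [T vT RT] := uv R uR; have [U uU TU] := vu T vT.
  have /and3P[_ triv _] := blocks_partition u.
  have [i Ri] := set0Pn _ (block_neq0 uR).
  have Ui : i \in U by apply: (subsetP TU); apply: (subsetP RT).
  have RU : R = U by rewrite -(def_pblock triv uR Ri) -(def_pblock triv uU Ui).
  by have -> : R = T by apply/eqP; rewrite eqEsubset RT RU TU.
have Eb : blocks x = blocks y by apply/eqP; rewrite eqEsubset !sub.
have Es s : sblock x s = sblock y s by apply/eqP; rewrite eqEsubset xys yxs.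
have sgnS (u v : lpart n Sigma) R s : (forall s, sblock u s = sblock v s) ->
    sgn u R = Some s -> sgn v R = Some s.
  move=> E uR; have /in_signsP : s \in signs v.
    by rewrite in_signs_neq0 -E (sgn_sblock uR) (block_neq0 (sgn_block uR)).
  by rewrite -E (sgn_sblock uR).
apply: val_inj; rewrite /= [lpart_data x]surjective_pairing.
rewrite [lpart_data y]surjective_pairing; congr (_, _); first exact: Eb.
apply/ffunP => R; rewrite -[LHS]/(sgn x R) -[RHS]/(sgn y R).
case E: (sgn x R) => [s|]; first by rewrite (sgnS x y R s).
case E': (sgn y R) => [s|//].
by rewrite (sgnS y x R s) in E => // s'; rewrite Es.
Qed.

Lemma lposet_le_refl (n : nat) (Sigma : finType) :
  reflexive (@lposet_le n Sigma).
Proof. by case=> //= x; apply: lpart_le_refl. Qed.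

Lemma lposet_le_anti (n : nat) (Sigma : finType) :
  antisymmetric (@lposet_le n Sigma).
Proof. by move=> [x|] [y|] //= /lpart_le_anti ->. Qed.

Lemma lposet_le_trans (n : nat) (Sigma : finType) :
  transitive (@lposet_le n Sigma).
Proof. by move=> [y|] [x|] [z|] //=; apply: lpart_le_trans. Qed.

Fact lposet_display : Order.disp_t. Proof. exact: Order.Disp tt tt. Qed.

HB.instance Definition _ (n : nat) (Sigma : finType) :=
  Order.Le_isPOrder.Build lposet_display (lposet n Sigma)
    (@lposet_le_refl n Sigma) (@lposet_le_anti n Sigma)
    (@lposet_le_trans n Sigma).

Lemma lpart0_subproof (n : nat) (Sigma : finType) :
  @lpart_axiom n Sigma ([set [set x] | x : dbl n], [ffun=> None]).
Proof.
have barN (x : dbl n) : x != bar x.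
  by case: x => i b; rewrite /bar xpair_eqE eqxx; case: b.
apply/and5P; split=> /=.
- apply/and3P; split.
  + apply/eqP/setP => x; rewrite inE; apply/bigcupP; exists [set x].
      exact: imset_f.
    exact: set11.
  + apply/trivIsetP => _ _ /imsetP[x _ ->] /imsetP[y _ ->] xy.
    rewrite disjoints1 inE; apply: contraNneq xy => ->; exact: eqxx.
  + apply/imsetP => -[x _ /setP/(_ x)]; by rewrite !inE eqxx.
- apply/forallP => R; apply/implyP => /imsetP[x _ ->].
  by rewrite /barset imset_set1 imset_f.
- by apply/forallP => S; rewrite ffunE.
- by apply/forallP => S; apply/forallP => S'; rewrite !ffunE.
- apply/forallP => S; apply/implyP => /imsetP[x _ ->].
  by rewrite ffunE /barset imset_set1 (inj_eq set1_inj) (negPf (barN x)).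
Qed.

(* The partition into singletons, i.e. the minimum of the poset.              *)
Definition lpart0 (n : nat) (Sigma : finType) : lpart n Sigma :=
  LPart (lpart0_subproof n Sigma).

Lemma lpartT_subproof (n : nat) (Sigma : finType) (n_gt0 : 0 < n)
    (s : Sigma) :
  @lpart_axiom n Sigma
    ([set setT], [ffun S => if S == setT then Some s else None]).
Proof.
have barT : barset [set: dbl n] = setT.
  apply/setP => -[i b]; rewrite inE; apply/imsetP; exists (i, ~~ b) => //.
  by rewrite /bar /= negbK.
apply/and5P; split=> /=.
- apply/and3P; split.
  + by rewrite /cover big_set1.
  + by apply/trivIsetP => A B; rewrite !inE => /eqP-> /eqP->; rewrite eqxx.
  + rewrite inE eq_sym; apply/set0Pn; exists (Ordinal n_gt0, true).
    exact: in_setT.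
- by apply/forallP => R; apply/implyP; rewrite !inE => /eqP->; rewrite barT.
- by apply/forallP => S; rewrite ffunE inE; case: (S == setT).
- apply/forallP => S; apply/forallP => S'; rewrite !ffunE.
  by case: (eqVneq S setT) => //= ->; case: (eqVneq S' setT) => //= _;
    apply/implyP.
- apply/forallP => S; apply/implyP; rewrite inE => /eqP->.
  by rewrite barT ffunE !eqxx.
Qed.

(* The element [n]_s, with the single block [[n]] signed by s.                *)
Definition lpartT (n : nat) (Sigma : finType) (n_gt0 : 0 < n) (s : Sigma) :
  lpart n Sigma := LPart (lpartT_subproof n_gt0 s).

(* The successor makes the representatives range over 1, ..., n.              *)
Definition rep (n : nat) (R : {set dbl n}) : nat :=
  (find (fun i : 'I_n => ((i, false) \in R) || ((i, true) \in R))
        (enum 'I_n)).+1.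

Definition normalized (n : nat) (R : {set dbl n}) : bool :=
  [exists i : 'I_n, (i.+1 == rep R) && ((i, false) \in R)].

Definition label := (nat *l nat)%type.

Definition sign_label (n : nat) (d : Order.disp_t) (Sigma : finOrderType d)
    (x : lpart n Sigma) (s : Sigma) : label :=
  if s \in signs x then (1, #|[set t in signs x | (t <= s)%O]|)
  else (1, #|[set t | (t <= s)%O] :|: signs x|).

(* If y covers x, exactly one of the first three cases applies, and the sign  *)
(* s, resp. the pair {q.1, q.2}, is unique. The value (0, 0) is junk.         *)
Definition lpart_label (n : nat) (d : Order.disp_t) (Sigma : finOrderType d)
    (x y : lpart n Sigma) : label :=
  let cand (R R' : {set dbl n}) :=
    [&& unsigned x R, unsigned x R', normalized R, normalized R' & R != R'] in
  if [pick s | sblock x s \proper sblock y s] is Some s then sign_label x s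
  else if [pick q | cand q.1 q.2 & q.1 :|: q.2 \in blocks y] is Some q
    then (0, maxn (rep q.1) (rep q.2))
  else if [pick q | cand q.1 q.2 & q.1 :|: barset q.2 \in blocks y] is Some q
    then (2, minn (rep q.1) (rep q.2))
  else (0, 0).

Definition lambda (n : nat) (d : Order.disp_t) (Sigma : finOrderType d)
    (x y : lposet n Sigma) : label :=
  match x, y with
  | _, None => (1, 2)
  | Some p, Some q => lpart_label p q
  | None, Some _ => (0, 0)
  end.

Definition covers_in (d : Order.disp_t) (T : finPOrderType d) (P : pred T)
    (x y : T) : bool :=
  [&& P x, P y, (x < y)%O & [forall z, P z ==> ~~ (x < z < y)%O]].

(* The chain a = x_0 < x_1 < ... < x_k = b is represented by the sequence     *)
(* p = [:: x_1; ...; x_k].                                                    *)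
Definition max_chain (d : Order.disp_t) (T : finPOrderType d) (P : pred T)
    (a b : T) (p : seq T) : bool :=
  path (covers_in P) a p && (last a p == b).

Definition decreasing (d : Order.disp_t) (T : finPOrderType d)
    (lam : T -> T -> label) (a : T) (p : seq T) : bool :=
  sorted (fun l l' : label => (l' <= l)%O) (pairmap lam a p).

(* The bound on the length of p excludes no chain (max_chain_size).           *)
Definition nb_dec_max_chains (d : Order.disp_t) (T : finPOrderType d)
    (P : pred T) (lam : T -> T -> label) (a b : T) : nat :=
  #|[set p : {bseq #|T| of T} | max_chain P a b p && decreasing lam a p]|.

Lemma max_chain_size (d : Order.disp_t) (T : finPOrderType d) (P : pred T)
  (a b : T) (p : seq T) : max_chain P a b p -> size p <= #|T|.
Proof.
case/andP=> pth _; have /lt_sorted_uniq : sorted <%O p.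
  apply: (@path_sorted _ _ a); apply: sub_path pth => x y.
  by case/and4P.
by move/card_uniqP <-; apply: max_card.
Qed.

Variant root_type := TypeB | TypeC | TypeD.

(* Only meaningful when s is the unique element of Sigma.                     *)
Definition subposet (t : root_type) (n : nat) (Sigma : finType) (s : Sigma) :
    pred (lposet n Sigma) :=
  fun x => match t, x with
  | TypeD, Some p => #|sblock p s| != 2
  | _, _ => true
  end.

Fixpoint dfact_nat (m : nat) : nat :=
  if m is m'.+2 then m * dfact_nat m' else 1.

(* The convention (-1)!! = 1 is the value on Negz 0.                          *)
Definition dfact (z : int) : nat := if z is Posz m then dfact_nat m else 1.

Definition coefficient (t : root_type) (n : nat) (pi : {set {set 'I_n}}) :
    nat :=
  match t with
  | TypeB | TypeC => #|pi|`!
  | TypeD => #|[set A in pi | 2 <= #|A|]| * (#|pi| - 1)`!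
  end.

(* Main.v *)
(** A decreasing chain uses non-coherent covers first, then covers of sign
    [sigma], and coherent covers last; as a coherent cover leaves an unsigned
    block that only sign covers can remove, a chain ending at [[n]_sigma] has
    none.  In the first phase the labels [(2, m)] run through m = n, ..., 1, and
    at stage m the block of m, so far a singleton, absorbs in some order some of
    the blocks with larger representatives.  Hence the number of completions
    depends only on the numbers a and b of non-singleton and singleton blocks
    with representatives above m: it is obtained by iterating an operator
    [adjoin] on functions of (a, b), starting from the number of ways to
    perform the sign phase, (a + b)! or a (a + b - 1)!.

    On the other side, (2 |A| - 3)!! counts increasing plane trees on A, and
    inserting a new largest element into set partitions turns the sum over
    partitions of i elements into the one over i + 1 elements by an operator
    [insert i].  The commutation [insert i \o adjoin = adjoin \o insert i.+1]
    shows that both iterations agree at (0, 0). *)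
Require Import Defs.
From mathcomp Require Import all_boot all_order all_algebra.
From mathcomp Require Import ring zify.

Set Implicit Arguments.
Unset Strict Implicit.
Unset Printing Implicit Defensive.
Import Order.TTheory GRing.Theory.

(** * Insertion operators *)

Section Operators.
Local Open Scope ring_scope.
Implicit Types (f g : nat -> nat -> int) (a b i m : nat).

(* The block of m is a non-singleton; there are a non-singleton and b singleton
   blocks it can still absorb, and g counts the completions once m is done. *)
Fixpoint absorb g a {struct a} : nat -> int :=
  fix absorb_a b {struct b} : int :=
    (if a is a'.+1 then a%:R * absorb g a' b else 0) +
    (if b is b'.+1 then b%:R * absorb_a b' else 0) + g a.+1 b.

(* Same as [absorb] when the block of m is still the singleton {m}. *)
Definition adjoin g a b : int :=
  a%:R * absorb g a.-1 b + b%:R * absorb g a b.-1 + g a b.+1.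

(* The new element becomes a singleton, joins one of the b singletons, or joins
   a block A with 2 <= |A| in 2 |A| - 1 ways; these weights sum to
   2 (i - b) - a. *)
Definition insert i f a b : int :=
  f a b.+1 + b%:R * f a.+1 b.-1 + (i.*2%:R - b.*2%:R - a%:R) * f a b.

Lemma absorbE g a b :
  absorb g a b = a%:R * absorb g a.-1 b + b%:R * absorb g a b.-1 + g a.+1 b.
Proof. by case: a b => [|a] [|b] //=; rewrite ?mul0r. Qed.

Lemma eq_insert i f f' : f =2 f' -> insert i f =2 insert i f'.
Proof. by move=> ff' a b; rewrite /insert !ff'. Qed.

(** By induction on a + b. The induction hypothesis moves [insert] inside the two recursive terms;
    after one unfolding of each remaining [absorb g], both sides are the same polynomial in values
    of g and of [absorb g]. *)
Lemma insert_absorb i g : insert i (absorb g) =2 absorb (insert i.+1 g).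
Proof.
move=> a b; have [N] := ubnP (a + b)%N; elim: N a b => // N IH a b ltN.
have IHa : a%:R * insert i (absorb g) a.-1 b =
    a%:R * absorb (insert i.+1 g) a.-1 b.
  by case: a ltN => [|a] ltN; rewrite ?mul0r ?IH.
have IHb : b%:R * insert i (absorb g) a b.-1 =
    b%:R * absorb (insert i.+1 g) a b.-1.
  by case: b {IHa} ltN => [|b] ltN; rewrite ?mul0r ?IH // -addnS.
rewrite [RHS]absorbE -{}IHa -{}IHb /insert.
rewrite (absorbE g a b.+1) (absorbE g a.+1 b.-1) !(absorbE g a b) /=.
(* The predecessors are truncated, and b is decremented twice, once by [insert] and once by
   [absorb]; hence three cases for b. *)
case: a ltN => [|a] ltN; case: b ltN => [|[|b]] ltN /=;
rewrite ?doubleS -?muln2 ?natrM -?natr1 ; by ring.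
Qed.

(** [adjoin] differs from [absorb] only in its last term, so [insert_absorb] leaves a linear
    identity in g. *)
Lemma insert_adjoin i g : insert i (adjoin g) =2 adjoin (insert i.+1 g).
Proof.
have adjoinE h a b : adjoin h a b = absorb h a b - h a.+1 b + h a b.+1.
  by rewrite absorbE /adjoin addrK.
move=> a b; rewrite [RHS]adjoinE -insert_absorb /insert !adjoinE.
case: b => [|b] /=; rewrite ?doubleS -?muln2 ?natrM -?natr1; by ring.
Qed.

(** The composite of [insert i], ..., [insert (i + m - 1)], the smallest index outermost: it
    describes m successive insertions into partitions of i elements. *)
Fixpoint inserts i m f : nat -> nat -> int :=
  if m is m'.+1 then insert i (inserts i.+1 m' f) else f.

Lemma inserts_rcons i m f :
  inserts i m.+1 f =2 inserts i m (insert (i + m) f).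
Proof.
elim: m i => [|m IH] i a b; first by rewrite addn0.
rewrite -[inserts i m.+2 f]/(insert i (inserts i.+1 m.+1 f)).
by rewrite (eq_insert _ (IH _)) addSnnS.
Qed.

Lemma inserts_adjoin i m f :
  inserts i m (adjoin f) =2 adjoin (inserts i.+1 m f).
Proof.
elim: m i => //= m IH i a b.
by rewrite (eq_insert _ (IH _)) insert_adjoin.
Qed.

(** At (0, 0) both [adjoin g] and [insert 0 g] reduce to [g 0 1]. So an [adjoin], once commuted to
    the outside, can be traded for an [insert 0]. *)
Lemma iter_adjoin00 m f : iter m adjoin f 0%N 0%N = inserts 0 m f 0%N 0%N.
Proof.
elim: m f => // m IH f; rewrite iterSr IH inserts_adjoin /=.
by rewrite /adjoin /insert /=; ring.
Qed.

End Operators.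

(** * Weighted sums over set partitions *)

Section Partitions.
Variable T : finType.
Implicit Types (x : T) (A B D : {set T}) (P Q : {set {set T}}).

Lemma partition_notin P D x A :
  partition P D -> x \notin D -> A \in P -> x \notin A.
Proof.
by move=> /partitionS sPD xD PA; apply: contra xD => /(subsetP (sPD _ PA)).
Qed.

Lemma partition_adjoin P D x A : partition P D -> x \notin D -> A \in P ->
  partition ((x |: A) |: P :\ A) (x |: D).
Proof.
move=> PD xD PA; have /and3P[/eqP cP tP P0] := PD.
have -> : x |: D = (x |: A) :|: (D :\: A).
  have sAD := partitionS PD PA.
  apply/setP => z; rewrite !inE; case: (z =P x) => //= _.
  by case: (boolP (z \in A)) => //= /(subsetP sAD).
apply: partitionU1; first exact: partitionD1.
  by apply/set0Pn; exists x; rewrite setU11.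
rewrite disjoints_subset; apply/subsetP => z; rewrite !inE.
by case: eqP => [-> _|_ /= ->] //=; rewrite (negPf xD) andbF.
Qed.

Lemma partition_remove P D x : partition P (x |: D) -> x \notin D ->
  pblock P x != [set x] ->
  partition ((pblock P x :\ x) |: P :\ pblock P x) D.
Proof.
move=> PD xD neq; have /and3P[/eqP cP tP P0] := PD.
set A := pblock P x; have xc : x \in cover P by rewrite cP setU11.
have PA : A \in P by rewrite pblock_mem.
have xA : x \in A by rewrite mem_pblock.
have sAD := partitionS PD PA.
have -> : D = (A :\ x) :|: ((x |: D) :\: A).
  apply/setP => z; rewrite !inE; have := subsetP sAD z; rewrite !inE.
  by case: (z =P x) => [->|_] /=; [rewrite xA (negPf xD)|case: (z \in A) =>
    // ->].
apply: partitionU1; first exact: partitionD1.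
  apply: contraNneq neq => /eqP; rewrite setD_eq0 => sAx.
  by rewrite -/A eqEsubset sAx sub1set.
rewrite disjoints_subset; apply/subsetP => z; rewrite !inE => /andP[_ ->].
by [].
Qed.

Local Open Scope ring_scope.

(** A partition of D with x added either has {x} as a block, or arises from a unique partition of D
    by adding x to one of its blocks. *)
Lemma sum_partition_insert (F : {set {set T}} -> int) x D : x \notin D ->
  \sum_(P | partition P (x |: D)) F P =
  \sum_(Q | partition Q D)
     (F ([set x] |: Q) + \sum_(A in Q) F ((x |: A) |: Q :\ A)).
Proof.
move=> xD; rewrite big_split /= (bigID (fun P => pblock P x == [set x])) /=.
have pbl P A : trivIset (A |: P) -> x \in A -> pblock (A |: P) x = A.
  by move=> tP xA; apply: def_pblock tP _ xA; rewrite setU11.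
have ext Q : partition Q D -> [set x] \notin Q.
  by move=> /partition_notin/(_ xD) QxA; apply/negP => /QxA; rewrite set11.
congr (_ + _).
  rewrite (reindex_onto (fun Q => [set x] |: Q) (fun P => P :\ [set x])) /=.
    apply: eq_bigl => Q; apply/andP/idP.
      case=> [/andP[PD _] /eqP E].
      have : partition (([set x] |: Q) :\ [set x]) ((x |: D) :\: [set x]).
        by apply: partitionD1 PD _; rewrite setU11.
      by rewrite E setU1K.
    move=> QD; have PD : partition ([set x] |: Q) (x |: D).
      apply: partitionU1 => //; last by rewrite disjoints1.
      by apply/set0Pn; exists x; rewrite set11.
    split; last by rewrite setU1K ?ext.
    rewrite PD /=; have /and3P[_ tP _] := PD.
    by rewrite pbl ?set11.
  move=> P /andP[PD /eqP E]; rewrite setD1K // -E.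
  by have /and3P[/eqP cP _ _] := PD; rewrite pblock_mem // cP setU11.
rewrite pair_big_dep /=.
(* Second kind: pairs (Q, A) with A in Q; the inverse map deletes x from its block. *)
rewrite (reindex_onto
  (fun p : {set {set T}} * {set T} => (x |: p.2) |: p.1 :\ p.2)
  (fun P => ((pblock P x :\ x) |: P :\ pblock P x, pblock P x :\ x))) /=.
  apply: eq_bigl => -[Q A] /=; apply/andP/andP.
    case=> [/andP[PD neq] /eqP[EQ EA]].
    have := partition_remove PD xD neq; rewrite EQ => QD; split=> //.
    pose P := (x |: A) |: Q :\ A.
    by have := setU11 (pblock P x :\ x) (P :\ pblock P x); rewrite /P EQ EA.
  case=> QD QA; have PD := partition_adjoin QD xD QA.
  have xA := partition_notin QD xD QA.
  have /and3P[_ tP _] := PD.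
  rewrite PD /= pbl ?setU11 //; split.
    have /set0Pn[z zA] : A != set0.
      by have /and3P[_ _ Q0] := QD; apply: contraNneq Q0 => <-.
    apply/negP => /eqP/setP/(_ z); rewrite !inE zA orbT => /esym/eqP zx.
    by rewrite -zx zA in xA.
  rewrite !setU1K //; first by rewrite setD1K.
  by rewrite !inE negb_and; apply/orP; right;
    apply/negP => /(partition_notin QD xD); rewrite setU11.
move=> P /andP[PD neq]; have /and3P[/eqP cP tP P0] := PD.
have xc : x \in cover P by rewrite cP setU11.
have Px : pblock P x \in P by rewrite pblock_mem.
rewrite setD1K ?mem_pblock // setU1K ?setD1K //.
(* The block of x without x cannot itself be a block: it is nonempty and meets the block of x, so
   the two would coincide. *)
rewrite !inE negb_and negbK; apply/orP; right; apply/negP => PA.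
have /set0Pn[z zA] : pblock P x :\ x != set0 by apply: contraNneq P0 => <-.
have : pblock P x = pblock P x :\ x.
  have zx : z \in pblock P x by move: zA; rewrite !inE => /andP[].
  by rewrite -[LHS](def_pblock tP Px zx) (def_pblock tP PA zA).
by move/setP/(_ x); rewrite mem_pblock xc !inE eqxx.
Qed.

Definition nonsingle P := #|[set A in P | 1 < #|A|]|%N.
Definition single P := #|[set A in P | #|A| == 1%N]|%N.
(** The number of ways to choose an increasing plane tree on every block. *)
Definition tree_weight P :
  int := \prod_(A in P) (dfact ((2 * #|A|)%N%:Z - 3))%:Z.

(** A new largest label can be attached to an increasing plane tree with m vertices in 2 m - 1
    places. The case [k = 0] rests on (-1)!! = 1. *)
Lemma dfact_tree k :
  (dfact ((2 * k.+2)%N%:Z - 3) = k.+1.*2.-1 * dfact ((2 * k.+1)%N%:Z - 3))%N.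
Proof.
have e m : ((2 * m.+2)%N%:Z - 3 = Posz m.*2.+1)%R by lia.
rewrite e; case: k => [//|k]; rewrite e doubleS /=; lia.
Qed.

Lemma card_filterU1 P A (p : pred {set T}) : A \notin P ->
  #|[set B in A |: P | p B]|%N = (p A + #|[set B in P | p B]|)%N.
Proof.
move=> PA; have -> : [set B in A |: P | p B] =
    (if p A then [set A] else set0) :|: [set B in P | p B].
  apply/setP => B; rewrite !inE; case pA: (p A); rewrite !inE.
    by case: (B =P A) => //= ->.
  by case: (B =P A) => //= ->; rewrite pA andbF.
rewrite cardsU; case: (p A); rewrite ?cards1 ?cards0.
  have -> : [set A] :&: [set B in P | p B] = set0.
    apply/setP => B; rewrite !inE; case: eqP => //= ->.
    by rewrite (negPf PA).
  by rewrite cards0 subn0.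
by rewrite set0I cards0 subn0.
Qed.

Lemma card_filterD1 P A (p : pred {set T}) : A \in P ->
  #|[set B in P | p B]|%N = (p A + #|[set B in P :\ A | p B]|)%N.
Proof. by move=> PA; rewrite -{1}(setD1K PA) card_filterU1 // setD11. Qed.

(** Each way to place x changes the pair of block counts and multiplies the weight by a factor
    depending only on the block that x joins; these factors add up to the coefficients of
    [insert]. *)
Lemma sum_tree_insert (f : nat -> nat -> int) x D : x \notin D ->
  \sum_(P | partition P (x |: D)) f (nonsingle P) (single P) * tree_weight P =
  \sum_(P | partition P D)
    insert #|D| f (nonsingle P) (single P) * tree_weight P.
Proof.
move=> xD; rewrite sum_partition_insert //; apply: eq_bigr => Q QD.
have QxA A : A \in Q -> x \notin A by apply: partition_notin QD xD.
have Q0 A : A \in Q -> (0 < #|A|)%N.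
  move=> QA; rewrite card_gt0; have /and3P[_ _ Q0] := QD.
  by apply: contraNneq Q0 => <-.
have nx : [set x] \notin Q by apply/negP => /QxA; rewrite set11.
rewrite {1}/nonsingle {1}/single {1}/tree_weight !card_filterU1 // cards1 /=.
rewrite big_setU1 //= cards1 mul1r add0n add1n.
pose a := nonsingle Q; pose b := single Q.
(* [g A] is the contribution of joining A, relative to the weight of Q. For a singleton the factor 2
   |A| - 1 is 1. *)
pose g A : int := if #|A| == 1%N then f a.+1 b.-1 else (#|A|.*2.-1)%:R * f a b.
have -> : \sum_(A in Q) f (nonsingle ((x |: A) |: Q :\ A))
      (single ((x |: A) |: Q :\ A)) * tree_weight ((x |: A) |: Q :\ A) =
    \sum_(A in Q) g A * tree_weight Q.
  apply: eq_bigr => A QA; have xA := QxA A QA.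
  have nA : (x |: A) \notin Q :\ A.
    by rewrite !inE negb_and; apply/orP; right; apply/negP => /QxA;
      rewrite setU11.
  rewrite /tree_weight big_setU1 //= [in RHS](big_setD1 A) //= !mulrA;
    congr (_ * _).
  rewrite /nonsingle /single !card_filterU1 // cardsU1 xA add1n.
  rewrite /g /a /b /nonsingle /single !(card_filterD1 _ QA).
  have := Q0 A QA; case: #|A| => // k _; rewrite dfact_tree eqSS.
  case: k => [|k] /=; first by rewrite add1n !mulr1.
  rewrite PoszM mulrA; congr (_ * _); rewrite mulrC; congr (_ * _).
  by rewrite natz.
rewrite -big_distrl /= -mulrDl; congr (_ * _).
rewrite /insert -/a -/b -addrA; congr (_ + _).
rewrite (bigID (fun A : {set T} => #|A| == 1%N)) /= /g; congr (_ + _).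
  rewrite (eq_bigr (fun=> f a.+1 b.-1)) => [|A /andP[_ ->] //].
  rewrite big_const iter_addr_0 [RHS]mulr_natl; congr (_ *+ _).
  by apply: eq_card => A; rewrite !inE.
rewrite (eq_bigr (fun A : {set T} => (#|A|.*2.-1)%:R * f a b)); last first.
  by move=> A /andP[_ /negPf ->].
rewrite -big_distrl /=; congr (_ * _).
(* It remains to sum 2 |A| - 1 over the a non-singleton blocks, which together contain |D| - b
   elements. *)
have eD : (#|D| = b + \sum_(A in Q | #|A| != 1) #|A|)%N.
  rewrite (card_partition QD) (bigID (fun A : {set T} => #|A| == 1%N)) /=.
  congr addn; rewrite /b /single -sum1_card big_mkcond [RHS]big_mkcond /=.
  by apply: eq_bigr => A _; rewrite inE; case: ifP => // /andP[_ /eqP->].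
have ea : a = (\sum_(A in Q | #|A| != 1) 1)%N.
  rewrite /a /nonsingle sum1dep_card; apply: eq_card => A; rewrite !inE.
  case QA: (A \in Q) => //=; have := Q0 A QA; by case: #|A| => [|[]].
have e2 : (\sum_(A in Q | #|A| != 1) #|A|.*2.-1 + a =
    (\sum_(A in Q | #|A| != 1) #|A|).*2)%N.
  rewrite ea -big_split /= -muln2 big_distrl /=.
  by apply: eq_bigr => A /andP[/Q0]; lia.
have aux (u v c d : nat) : (u + c = v.*2)%N ->
    u%:Z = (d + v)%N.*2%:Z - d.*2%:Z - c%:Z by clear; lia.
by rewrite -natr_sum !natz eD; apply: aux e2.
Qed.

(** Removing one element of D peels off the innermost [insert], whose index is |D| - 1; the empty
    set has only the empty partition. *)
Lemma sum_treeE (f : nat -> nat -> int) D :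
  \sum_(P | partition P D) f (nonsingle P) (single P) * tree_weight P =
  inserts 0 #|D| f 0%N 0%N.
Proof.
elim: {D}_.+1 {-2}D (ltnSn #|D|) f => // N IH D ltD f.
case: (set_0Vmem D) => [->|[x xD]].
  rewrite (eq_bigl (pred1 set0)) => [|P]; last by rewrite partition_set0.
  rewrite big_pred1_eq cards0 /= /tree_weight big_set0 mulr1.
  by congr (f _ _); apply: eq_card0 => A; rewrite !inE.
rewrite -(setD1K xD) sum_tree_insert ?setD11 // setD1K //.
have DE := cardsD1 x D; rewrite xD add1n in DE.
rewrite IH; last by rewrite DE in ltD.
by rewrite [in RHS]DE inserts_rcons add0n.
Qed.
End Partitions.

(** * Encoding labeled partitions by functions *)

Section Doubled.
Variable n : nat.
Implicit Types (i j k : 'I_n) (z w : dbl n) (R : {set dbl n}).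

Lemma barK : involutive (@bar n).
Proof. by case=> i b; rewrite /bar /= negbK. Qed.

Lemma bar_neq z : (bar z == z) = false.
Proof. by case: z => i []; rewrite /bar xpair_eqE eqxx. Qed.

Lemma dbl_eqVbar z w : z.1 = w.1 -> z = w \/ z = bar w.
Proof.
by case: z w => i [] [j []] /= ->; [left|right|right|left].
Qed.

Lemma in_barset z R : (z \in barset R) = (bar z \in R).
Proof.
apply/imsetP/idP => [[w Rw ->]|Rz]; first by rewrite barK.
by exists (bar z); rewrite ?barK.
Qed.

Lemma rep_min z R : z \in R -> rep R <= z.1.+1.
Proof.
move=> Rz; rewrite /rep ltnS; set p := (X in find X _).
have pz : p z.1 by rewrite /p; case: z Rz => i [] /= ->; rewrite ?orbT.
rewrite leqNgt; apply/negP => /(before_find z.1).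
by rewrite nth_ord_enum pz.
Qed.

Lemma rep_attained z R : z \in R -> exists2 w, w \in R & w.1.+1 = rep R.
Proof.
move=> Rz; rewrite /rep; set p := (X in find X _).
have hp : has p (enum 'I_n).
  apply/hasP; exists z.1; first by rewrite mem_enum.
  by rewrite /p; case: z Rz => i [] /= ->; rewrite ?orbT.
have lt_n : find p (enum 'I_n) < n by rewrite -[X in _ < X]size_enum_ord
  -has_find.
have := nth_find z.1 hp;
  rewrite -[find _ _]/(nat_of_ord (Ordinal lt_n)) nth_ord_enum.
by case/orP=> Rw; [exists (Ordinal lt_n, false)|exists (Ordinal lt_n, true)].
Qed.

Lemma rep_uniq z R : z \in R -> (forall w, w \in R -> z.1 <= w.1) ->
  rep R = z.1.+1.
Proof.
move=> Rz zmin; apply/eqP; rewrite eqn_leq rep_min //=.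
by have [w Rw <-] := rep_attained Rz; rewrite ltnS zmin.
Qed.

(** Treats the identity and the bar uniformly, composition being exclusive or. *)
Definition twist (b : bool) z : dbl n := (z.1, z.2 (+) b).

(* Extension of F to [[n]] commuting with the bar. *)
Definition spread (F : {ffun 'I_n -> option (dbl n)}) z : option (dbl n) :=
  omap (twist z.2) (F z.1).

(** These conditions characterize the encodings of partitions, see [enc_canonical] and
    [enc_surj]. *)
Definition canonical (F : {ffun 'I_n -> option (dbl n)}) : Prop :=
  forall i w, F i = Some w -> F w.1 = Some (w.1, false) /\ w.1 <= i.

(** A root stands for a pair of unsigned blocks R and its bar; it is the least underlying integer of
    R. *)
Definition roots (F : {ffun 'I_n -> option (dbl n)}) : {set 'I_n} :=
  [set i | F i == Some (i, false)].

Lemma twist0 z : twist false z = z.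
Proof. by case: z => i b; rewrite /twist addbF. Qed.

Lemma twistD b c z : twist b (twist c z) = twist (c (+) b) z.
Proof. by rewrite /twist /= addbA. Qed.

Lemma spread_false F i : spread F (i, false) = F i.
Proof. by rewrite /spread /=; case: (F i) => //= w; rewrite twist0. Qed.

Lemma spread_twist F b z : spread F (twist b z) = omap (twist b) (spread F z).
Proof. by rewrite /spread /=; case: (F z.1) => //= w; rewrite twistD. Qed.

Lemma spread_bar F z : spread F (bar z) = omap (@bar n) (spread F z).
Proof.
have barE w : bar w = twist true w by rewrite /bar /twist addbT.
by rewrite barE spread_twist; case: spread => //= w; rewrite barE.
Qed.

Lemma spread_canon F z w : canonical F -> spread F z = Some w ->
  spread F w = Some w /\ w.1 <= z.1.
Proof.
move=> cF; rewrite /spread; case E: (F z.1) => [u|] //= [<-] /=.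
by have [-> ->] := cF _ _ E.
Qed.
End Doubled.

(** * Partitions with a single sign as functions to representatives *)

Section Encoding.
Variables (n : nat) (Sigma : finType) (sigma : Sigma).
Hypothesis Sigma1 : [set: Sigma] = [set sigma].
Implicit Types (x y : lpart n Sigma) (i j k : 'I_n) (z w : dbl n).
Implicit Types (R : {set dbl n}).

Lemma SigmaE s : s = sigma.
Proof. by apply/set1P; rewrite -Sigma1 inE. Qed.

Definition blk x z := pblock (blocks x) z.

Lemma mem_blk x z : z \in blk x z.
Proof.
by rewrite mem_pblock (cover_partition (blocks_partition x)) inE.
Qed.

Lemma blk_block x z : blk x z \in blocks x.
Proof.
by rewrite pblock_mem // (cover_partition (blocks_partition x)) inE.
Qed.

Lemma blkE x z R : R \in blocks x -> z \in R -> R = blk x z.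
Proof.
move=> xR Rz; have /and3P[_ tx _] := blocks_partition x.
by rewrite [RHS](def_pblock tx xR Rz).
Qed.

Lemma blk_eq x z w : w \in blk x z -> blk x w = blk x z.
Proof. by move/(blkE (blk_block x z)) ->. Qed.

Lemma barset_block x R : R \in blocks x -> barset R \in blocks x.
Proof. by have /and5P[_ /forall_inP H _ _ _] := lpart_dataP x => /H. Qed.

Lemma blk_bar x z : blk x (bar z) = barset (blk x z).
Proof.
apply/esym/blkE; first exact/barset_block/blk_block.
by rewrite in_barset barK mem_blk.
Qed.

Lemma signedE x R : R \in blocks x -> (sgn x R != None) = (R == barset R).
Proof.
by have /and5P[_ _ _ _ /forall_inP H] := lpart_dataP x => /H/eqP.
Qed.

Lemma sblock_blk x z : z \in sblock x sigma -> sblock x sigma = blk x z.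
Proof.
move=> Sz; have /in_signsP/sgn_block xS : sigma \in signs x.
  by rewrite in_signs_neq0; apply/set0Pn; exists z.
exact: blkE.
Qed.

(** A block is signed exactly when it is stable under the bar, and there is only one sign. *)
Lemma in_sblock x z : (z \in sblock x sigma) = (bar z \in blk x z).
Proof.
apply/idP/idP => [Sz|bz].
  have E := sblock_blk Sz; have : sigma \in signs x.
    by rewrite in_signs_neq0; apply/set0Pn; exists z.
  move/in_signsP; rewrite E => Es.
  have : blk x z == barset (blk x z) by rewrite -(signedE (blk_block x z)) Es.
  by move=> /eqP ->; rewrite in_barset barK mem_blk.
have : sgn x (blk x z) != None.
  by rewrite signedE ?blk_block // -blk_bar (blk_eq bz).
case E: (sgn x (blk x z)) => [s|] // _.
by rewrite (SigmaE s) in E; rewrite (sgn_sblock E) mem_blk.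
Qed.

Lemma sblock_bar x z : (bar z \in sblock x sigma) = (z \in sblock x sigma).
Proof. by rewrite !in_sblock barK blk_bar in_barset. Qed.

(* [enc x i] is [None] if i lies in the signed block, and otherwise the element
   of the block of i (possibly barred) with least underlying integer. *)
Definition enc x : {ffun 'I_n -> option (dbl n)} :=
  [ffun i => if (i, false) \in sblock x sigma then None
    else [pick w in blk x (i, false) | w.1.+1 == rep (blk x (i, false))]].

Lemma spread_encN x z : (spread (enc x) z == None) = (z \in sblock x sigma).
Proof.
have -> : (z \in sblock x sigma) = ((z.1, false) \in sblock x sigma).
  by case: z => i [] //; rewrite -[(i, true)]/(bar (i, false)) sblock_bar.
rewrite /spread ffunE; case: ifP => //= _; case: pickP => //=.
have [w Rw Ew] := rep_attained (mem_blk x (z.1, false)).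
by move/(_ w); rewrite Rw Ew eqxx.
Qed.

Lemma spread_encS x z w : spread (enc x) z = Some w ->
  [/\ w \in blk x z, w.1.+1 = rep (blk x z) & z \notin sblock x sigma].
Proof.
move=> E; have -> : z \notin sblock x sigma by rewrite -spread_encN E.
have main i u : enc x i = Some u ->
    u \in blk x (i, false) /\ u.1.+1 = rep (blk x (i, false)).
  by rewrite ffunE; case: ifP => // _; case:
    pickP => // v /andP[Rv /eqP Ev] [<-].
move: E; rewrite /spread; case: z => i b /=.
case E: (enc x i) => [u|] //= [<-]; have [Ru Eu] := main _ _ E.
case: b; last by rewrite twist0.
rewrite -[(i, true)]/(bar (i, false)) blk_bar in_barset.
have -> : bar (twist true u) = u by case: (u) => ? [].
split=> //=; rewrite Eu.
have [v Rv Ev] := rep_attained (mem_blk x (i, false)).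
rewrite -Ev; apply/esym/(@rep_uniq _ (bar v)); first by rewrite in_barset barK.
by move=> t; rewrite in_barset => /rep_min; rewrite -Ev.
Qed.

(** An unsigned block contains its least integer in only one of the two forms, plain or barred,
    since containing both would make it signed; so all its elements get the same representative. *)
Lemma spread_enc_eq x z w :
  (spread (enc x) z == spread (enc x) w) = (w \in blk x z).
Proof.
apply/eqP/idP => [E|wz].
  case Ez: (spread (enc x) z) => [u|].
    have [zu _ _] := spread_encS Ez; rewrite E in Ez.
    have [wu _ _] := spread_encS Ez.
    by rewrite -(blk_eq zu) (blk_eq wu) mem_blk.
  move/eqP: (Ez); rewrite spread_encN => /sblock_blk <-.
  by rewrite -spread_encN -E Ez.
have bE := blk_eq wz.
case Ez: (spread (enc x) z) => [u|]; last first.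
  move/eqP: Ez; rewrite spread_encN => Sz; apply/esym/eqP.
  by rewrite spread_encN (sblock_blk Sz).
have [zu Eu Nz] := spread_encS Ez.
case Ew: (spread (enc x) w) => [v|]; last first.
  move/eqP: Ew; rewrite spread_encN => Sw.
  by rewrite (sblock_blk Sw) bE mem_blk in Nz.
have [wv Ev Nw] := spread_encS Ew.
have /dbl_eqVbar[->//|uv] : u.1 = v.1.
  by apply/ord_inj/succn_inj; rewrite Eu Ev bE.
have : v \in sblock x sigma by rewrite in_sblock -uv (blk_eq wv) bE.
move=> Sv; case/negP: Nw; rewrite (sblock_blk Sv) (blk_eq wv) mem_blk //.
Qed.

Lemma blk_enc x z : blk x z = [set w | spread (enc x) z == spread (enc x) w].
Proof. by apply/setP => w; rewrite inE spread_enc_eq. Qed.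

Lemma enc_canonical x : canonical (enc x).
Proof.
move=> i w; rewrite -spread_false => E.
have [Rw Ew Nw] := spread_encS E.
have := Rw; rewrite -spread_enc_eq E eq_sym => /eqP Ew'; split.
  move: Ew'; rewrite /spread; case: (enc x w.1) => [[j c]|] //=.
  by case: (w) => k []; case: c => // -[->].
by rewrite -ltnS Ew; apply: (@rep_min _ (i, false)); apply: mem_blk.
Qed.

(** The order read on encodings: G is determined by its values at the representatives of F, and what
    F already signs stays signed. *)
Definition refines (F G : {ffun 'I_n -> option (dbl n)}) :=
  forall i, G i = obind (spread G) (F i).

Lemma refines_spread F G z : refines F G ->
  spread G z = obind (spread G) (spread F z).
Proof.
move=> FG; rewrite {1 3}/spread FG; case: (F z.1) => //= w.
by rewrite spread_twist.
Qed.

Lemma lpart_le_enc x y : lpart_le x y <-> refines (enc x) (enc y).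
Proof.
split=> [/lpart_leP[xys xyb] i|FG].
  case E: (enc x i) => [w|] /=.
    move: E; rewrite -!spread_false => /spread_encS[wi _ _].
    apply/eqP; rewrite spread_enc_eq.
    have [T yT RT] := xyb _ (blk_block x (i, false)).
    by rewrite -(blkE yT (subsetP RT _ (mem_blk _ _))) (subsetP RT).
  apply/eqP; rewrite -spread_false spread_encN.
  by apply: (subsetP (xys sigma)); rewrite -spread_encN spread_false E.
apply/lpart_leP; split=> [s|R xR].
  rewrite (SigmaE s); apply/subsetP => z; rewrite -!spread_encN => /eqP Ez.
  by rewrite (refines_spread _ FG) Ez.
have /set0Pn[z Rz] := block_neq0 xR.
exists (blk y z); first exact: blk_block.
apply/subsetP => w; rewrite (blkE xR Rz) -!spread_enc_eq => /eqP E.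
by rewrite !(refines_spread _ FG) E.
Qed.

Lemma enc_inj : injective enc.
Proof.
have refl x : refines (enc x) (enc x) by apply/lpart_le_enc/lpart_le_refl.
move=> x y E; apply: lpart_le_anti.
by apply/andP; split; apply/lpart_le_enc; rewrite E; apply: refl.
Qed.

(** The blocks are the fibres of [spread F], and the fibre over [None], if nonempty, is signed. No
    other fibre is stable under the bar, which has no fixed point. *)
Lemma enc_surj F : canonical F -> {x | enc x = F}.
Proof.
move=> cF; pose fib z := [set w | spread F z == spread F w].
pose Bs : {set {set dbl n}} := [set fib z | z : dbl n].
have fibE z w : spread F z = spread F w -> fib z = fib w.
  by move=> E; apply/setP => u; rewrite !inE E.
have fib_bar z : barset (fib z) = fib (bar z).
  apply/setP => w; rewrite in_barset !inE !spread_bar.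
  by case: spread => [u|]; case: spread => [v|] //=;
    rewrite !(inj_eq Some_inj) (can2_eq (@barK n) (@barK n)).
pose sg : {ffun {set dbl n} -> option Sigma} :=
  [ffun S => if [exists z, (spread F z == None) && (S == fib z)] then Some
    sigma else None].
have ax : lpart_axiom (Bs, sg).
  apply/and5P; split=> /=.
  - rewrite (_ : Bs = preim_partition (spread F) setT) ?preim_partitionP //.
    apply/setP => S; apply/imsetP/imsetP => -[z _ ->]; exists z => //.
      by apply/setP => w; rewrite !inE.
    by apply/setP => w; rewrite !inE.
  - apply/forall_inP => _ /imsetP[z _ ->]; rewrite fib_bar; exact: imset_f.
  - apply/forallP => S; apply/implyP; rewrite ffunE; case: existsP => // -[z].
    by case/andP=> _ /eqP -> _; apply: imset_f.
  - apply/forallP => S; apply/forallP => S'; apply/implyP; rewrite !ffunE.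
    case: existsP => // -[z /andP[/eqP Ez /eqP ->]].
    case: existsP => // -[w /andP[/eqP Ew /eqP ->]] _.
    by apply/eqP/fibE; rewrite Ez Ew.
  - apply/forall_inP => _ /imsetP[z _ ->]; apply/eqP; rewrite ffunE fib_bar.
    case: existsP => /= [[w /andP[/eqP Ew /eqP E]]|nex].
      have zfib : z \in fib w by rewrite -E inE.
      rewrite inE Ew in zfib; apply/eqP/fibE; rewrite spread_bar.
      by rewrite -(eqP zfib).
    apply/negP => /eqP E; have : bar z \in fib z by rewrite E inE.
    rewrite inE spread_bar; case Ez: spread => [u|]; last first.
      by case: nex; exists z; rewrite Ez !eqxx.
    by rewrite /= (inj_eq Some_inj) eq_sym bar_neq.
exists (LPart ax); set x := LPart ax.
have blkx z : blk x z = fib z.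
  by apply/esym/blkE; [apply: imset_f|rewrite inE].
have Sx z : (z \in sblock x sigma) = (spread F z == None).
  rewrite in_sblock blkx inE spread_bar.
  by case: spread => [u|] //=; rewrite (inj_eq Some_inj) eq_sym bar_neq.
apply/ffunP => i; rewrite -!spread_false.
case E: (spread (enc x) (i, false)) => [w|]; last first.
  by apply/esym/eqP; rewrite -Sx -spread_encN E.
have [Rw Ew Nw] := spread_encS E.
case EF: (spread F (i, false)) => [u|]; last by rewrite Sx EF in Nw.
have [Eu _] := spread_canon cF EF.
have Ru : u \in fib (i, false) by rewrite inE EF Eu.
rewrite blkx in Rw Ew.
have : rep (fib (i, false)) = u.1.+1.
  apply: rep_uniq Ru _ => v; rewrite inE EF eq_sym => /eqP Ev.
  by have [_] := spread_canon cF Ev.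
(* Both representatives have the least underlying integer, so they agree up to a bar; the barred
   case contradicts that they lie in the same fibre. *)
rewrite -Ew => -[/ord_inj /dbl_eqVbar[->//|wu]].
have : spread F w == spread F u by rewrite inE in Rw; rewrite -(eqP Rw) EF Eu.
by rewrite wu spread_bar Eu /= (inj_eq Some_inj) bar_neq.
Qed.

End Encoding.

Arguments enc_canonical {n Sigma sigma} _ _ _ _ _.

(** * Covers and labels *)

Section Steps.
Variable n : nat.
Implicit Types (i j k : 'I_n) (z w : dbl n) (e : bool).
Implicit Types (F G : {ffun 'I_n -> option (dbl n)}).

(** The block of the root j joins the signed block. *)
Definition zero_out F j : {ffun 'I_n -> option (dbl n)} :=
  [ffun i => if F i is Some w then if w.1 == j then None else Some w else None].

(** The block of the root k is merged into that of j, after a bar if e is true; so e tells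
    non-coherent from coherent covers. *)
Definition fuse F j k e : {ffun 'I_n -> option (dbl n)} :=
  [ffun i => if F i is Some w then
     if w.1 == k then Some (j, w.2 (+) e) else Some w else None].

Lemma rootsE F i : i \in roots F -> F i = Some (i, false).
Proof. by rewrite inE => /eqP. Qed.

Lemma canon_root F i w : canonical F -> F i = Some w -> w.1 \in roots F.
Proof. by move=> cF /cF[E _]; rewrite inE E. Qed.

Lemma canon_self F i e : canonical F -> F i = Some (i, e) -> e = false.
Proof. by move=> cF E; have [] := cF _ _ E; rewrite /= E => -[]. Qed.

Lemma zero_out_canonical F j : canonical F -> canonical (zero_out F j).
Proof.
move=> cF i w; rewrite !ffunE; case E: (F i) => [u|] //.
case: eqP => // uj [<-]; have [Eu le] := cF _ _ E.
by rewrite Eu /=; case: eqP.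
Qed.

Lemma fuse_canonical F j k e : canonical F -> j \in roots F -> j < k ->
  canonical (fuse F j k e).
Proof.
move=> cF /rootsE Fj ltjk i w; rewrite !ffunE; case E: (F i) => [u|] //.
have [Eu le] := cF _ _ E.
case: eqP => [uk|/eqP uk] [<-] /=.
  rewrite Fj /= ifN; last by rewrite neq_ltn ltjk.
  by rewrite -uk in ltjk; split=> //; apply: leq_trans (ltnW ltjk) le.
by rewrite Eu /= (negPf uk).
Qed.

Lemma roots_zero_out F j : roots (zero_out F j) = roots F :\ j.
Proof.
apply/setP => i; rewrite !inE ffunE; case: (F i) => [w|]; last by rewrite andbF.
case: (w.1 =P j) => [wj|/eqP wj].
  case: (i =P j) => [//|ij] /=; apply/esym/negP => /eqP[wi].
  by apply: ij; rewrite -wj wi.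
case: (i =P j) => //= ij; apply/negP => /eqP[wi].
by move: wj; rewrite wi ij eqxx.
Qed.

Lemma roots_fuse F j k e : canonical F -> j \in roots F -> j < k ->
  roots (fuse F j k e) = roots F :\ k.
Proof.
move=> cF /rootsE Fj ltjk; apply/setP => i; rewrite !inE ffunE.
case E: (F i) => [w|]; last by rewrite andbF.
case: (w.1 =P k) => [wk|/eqP wk].
  apply/idP/idP => [/eqP[ji _]|/andP[ik /eqP[wi]]].
    by move: E wk; rewrite -ji Fj => -[<-] /= jk; rewrite jk ltnn in ltjk.
  by move: wk ik; rewrite wi /= => ->; rewrite eqxx.
case: (i =P k) => //= ik; apply/negP => /eqP[wi].
by move: wk; rewrite wi ik eqxx.
Qed.

(** If k is a root of G and l represents k in F, then l <= k, and G sends l to k up to a bar, so k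
    <= l. *)
Lemma refines_roots F G : canonical F -> canonical G -> refines F G ->
  roots G \subset roots F.
Proof.
move=> cF cG FG; apply/subsetP => k /rootsE Gk.
move: (FG k); rewrite Gk; case E: (F k) => [[l b]|] //= /esym El.
have [_ /= lek] := cF _ _ E.
have [_ /=] := spread_canon cG El => kl.
have lk : l = k by apply/ord_inj/eqP; rewrite eqn_leq lek kl.
by rewrite lk in E; rewrite inE E (canon_self cF E).
Qed.

Lemma refines_roots_eq F G : canonical F -> refines F G ->
  roots F \subset roots G -> F = G.
Proof.
move=> cF FG sFG; apply/ffunP => i; rewrite FG; case E: (F i) => [w|] //=.
have /rootsE := subsetP sFG _ (canon_root cF E).
by rewrite /spread => -> /=; case: (w).
Qed.

Lemma refines_zero_outl F G j : refines F G -> G j = None ->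
  refines (zero_out F j) G.
Proof.
move=> FG Gj i; rewrite ffunE FG; case: (F i) => //= w.
by case: eqP => [wj|] //=; rewrite /spread wj Gj.
Qed.

Lemma refines_fusel F G j k e : refines F G -> G k = omap (twist e) (G j) ->
  refines (fuse F j k e) G.
Proof.
move=> FG Gk i; rewrite ffunE FG; case: (F i) => //= w.
case: eqP => [wk|] //=; rewrite /spread wk Gk /=; case: (G j) => //= u.
by rewrite twistD addbC.
Qed.

Lemma refines_zero_out F j : canonical F -> refines F (zero_out F j).
Proof.
move=> cF i; rewrite ffunE; case E: (F i) => [w|] //=.
have [Ew _] := cF _ _ E; rewrite /spread ffunE Ew /=.
by case: eqP => //=; case: (w).
Qed.

Lemma refines_fuse F j k e : canonical F -> refines F (fuse F j k e).
Proof.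
move=> cF i; rewrite ffunE; case E: (F i) => [w|] //=.
have [Ew _] := cF _ _ E; rewrite /spread ffunE Ew /=.
by case: eqP => [wk|] //=; [rewrite /twist /= addbC|case: (w)].
Qed.
End Steps.

(** * Covers are elementary steps *)

Section Covers.
Variables (n : nat) (d : Order.disp_t) (Sigma : finOrderType d) (sigma : Sigma).
Hypothesis Sigma1 : [set: Sigma] = [set sigma].
Variable t : root_type.
Implicit Types (x y : lpart n Sigma) (i j k : 'I_n) (z w : dbl n) (e : bool).

Definition dec (F : {ffun 'I_n -> option (dbl n)}) : lpart n Sigma :=
  odflt (lpart0 n Sigma) [pick x | enc sigma x == F].

Lemma decK F : canonical F -> enc sigma (dec F) = F.
Proof.
move=> /(enc_surj Sigma1)[x E]; rewrite /dec; case: pickP => [y /eqP //|/(_ x)].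
by rewrite E eqxx.
Qed.

(** The underlying integers of the signed block; [cell] gives those of the unsigned block with root
    j. *)
Definition zeros x := [set i | enc sigma x i == None].
Definition cell x j := [set i | omap fst (enc sigma x i) == Some j].
Definition lroots x := roots (enc sigma x).
Definition sign_step x j := dec (zero_out (enc sigma x) j).
Definition merge_step x j k e := dec (fuse (enc sigma x) j k e).

Let cenc x : canonical (enc sigma x) := enc_canonical Sigma1 x.
Arguments cenc : clear implicits.

Lemma enc_sign_step x j : enc sigma (sign_step x j) = zero_out (enc sigma x) j.
Proof. exact/decK/zero_out_canonical. Qed.

Lemma enc_merge_step x j k e : j \in lroots x -> j < k ->
  enc sigma (merge_step x j k e) = fuse (enc sigma x) j k e.
Proof. by move=> xj ltjk; apply/decK/fuse_canonical. Qed.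

Lemma lroots_sign_step x j : lroots (sign_step x j) = lroots x :\ j.
Proof. by rewrite /lroots enc_sign_step roots_zero_out. Qed.

Lemma lroots_merge_step x j k e : j \in lroots x -> j < k ->
  lroots (merge_step x j k e) = lroots x :\ k.
Proof. by move=> xj ltjk; rewrite /lroots enc_merge_step ?roots_fuse. Qed.

Lemma zeros_sign_step x j : zeros (sign_step x j) = zeros x :|: cell x j.
Proof.
apply/setP => i; rewrite !inE enc_sign_step ffunE; case: (enc sigma x i) =>
  [w|] //=.
by rewrite (inj_eq Some_inj); case: (w.1 =P j).
Qed.

Lemma zeros_merge_step x j k e : j \in lroots x -> j < k ->
  zeros (merge_step x j k e) = zeros x.
Proof.
move=> xj ltjk; apply/setP => i; rewrite !inE enc_merge_step // ffunE.
by case: (enc sigma x i) => [w|] //=; case: (w.1 =P k).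
Qed.

Lemma cell_merge_step x j k e i : j \in lroots x -> j < k ->
  cell (merge_step x j k e) i =
  if i == j then cell x j :|: cell x k else
  if i == k then set0 else cell x i.
Proof.
move=> xj ltjk; apply/setP => l; rewrite inE enc_merge_step // ffunE.
have jk : (j == k) = false by apply/negP => /eqP E; rewrite E ltnn in ltjk.
case: (i =P j) => [->|/eqP ij]; last case: (i =P k) => [->|/eqP ik];
  rewrite !inE; case: (enc sigma x l) => [w|] //=; case: (w.1 =P k) =>
    [wk|/eqP wk] //=;
  rewrite !(inj_eq Some_inj) ?wk ?jk ?eqxx ?(negPf wk) ?orbT ?orbF //.
- by rewrite eq_sym (negPf ij) eq_sym (negPf ik).
Qed.

Lemma cell_root x j : j \in lroots x -> j \in cell x j.
Proof. by move/rootsE; rewrite inE => ->. Qed.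

(** The signed block is stable under the bar, so the type D condition says that [zeros] does not
    have exactly one element. *)
Lemma card_sblock x : #|sblock x sigma| = (#|zeros x|).*2.
Proof.
have -> : sblock x sigma = setX (zeros x) setT.
  apply/setP => -[i b]; rewrite -(spread_encN Sigma1) !inE andbT /spread /=.
  by case: (enc sigma x i).
by rewrite cardsX cardsT card_bool muln2.
Qed.

Definition in_subposet x := subposet t sigma (Some x).

Lemma in_subposetE x :
  in_subposet x = if t is TypeD then #|zeros x| != 1 else true.
Proof.
rewrite /in_subposet /subposet; case: t => //; rewrite card_sblock.
by case: #|zeros x| => [|[]].
Qed.

Lemma lt_enc x y : (Some x < Some y :> lposet n Sigma)%O <->
  enc sigma x <> enc sigma y /\ refines (enc sigma x) (enc sigma y).
Proof.
rewrite lt_neqAle; split=> [/andP[neq /(lpart_le_enc Sigma1) le]|[neq le]].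
  by split=> // /(enc_inj Sigma1) E; rewrite E eqxx in neq.
apply/andP; split; last exact/(lpart_le_enc Sigma1).
by apply/eqP => -[E]; rewrite E in neq.
Qed.

Lemma lt_lroots x y : (Some x < Some y :> lposet n Sigma)%O ->
  lroots y \proper lroots x.
Proof.
move/lt_enc=> [neq le]; rewrite properE refines_roots //=.
by apply/negP => /(refines_roots_eq (cenc x) le).
Qed.

Variant elementary x y : Prop :=
| ElemSign j of j \in lroots x & y = sign_step x j
| ElemMerge j k e of j \in lroots x & k \in lroots x & j < k & y = merge_step
  x j k e.

Lemma elementary_lt x y : elementary x y ->
  (Some x < Some y :> lposet n Sigma)%O.
Proof.
case=> [j xj ->|j k e xj xk ltjk ->]; apply/lt_enc.
  rewrite enc_sign_step; split; last exact: refines_zero_out.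
  by move/(congr1 (@roots n)); rewrite roots_zero_out => /setP/(_ j);
    rewrite xj setD11.
rewrite enc_merge_step //; split; last exact: refines_fuse.
by move/(congr1 (@roots n)); rewrite roots_fuse // => /setP/(_ k);
  rewrite xk setD11.
Qed.

Lemma elementary_card x y : elementary x y -> #|lroots x| = (#|lroots y|).+1.
Proof.
case=> [j xj ->|j k e xj xk ltjk ->].
  by rewrite lroots_sign_step (cardsD1 j) xj.
by rewrite lroots_merge_step // (cardsD1 k) xk.
Qed.

(** Choose a root j of x that is not a root of y. If y places j under a smaller root k, merge j into
    k. If y signs j, sign its block, unless type D forbids it; then merge it with another block that
    y also signs. *)
Lemma elementary_below x y : in_subposet x -> in_subposet y ->
  (Some x < Some y :> lposet n Sigma)%O ->
  exists w : lpart n Sigma, [/\ elementary x w, in_subposet w & lpart_le w y].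
Proof.
move=> Px Py lt; have [neq le] := (lt_enc x y).1 lt.
have /subsetPn[j xj yj] : ~~ (lroots x \subset lroots y).
  by have := lt_lroots lt; rewrite properE => /andP[].
have mergeP k l e : k \in lroots x -> l \in lroots x -> k < l ->
    enc sigma y l = omap (twist e) (enc sigma y k) ->
    exists w : lpart n Sigma, [/\ elementary x w, in_subposet w & lpart_le w y].
  move=> xk xl ltkl E; exists (merge_step x k l e); split.
  - exact: (ElemMerge (e := e) xk xl ltkl).
  - by move: Px; rewrite !in_subposetE zeros_merge_step.
  - by apply/(lpart_le_enc Sigma1); rewrite enc_merge_step //; apply:
    refines_fusel.
case Ey: (enc sigma y j) => [[k e]|]; last first.
  have [Pw|Pw] := boolP (in_subposet (sign_step x j)).
    exists (sign_step x j); split=> //; first exact: (ElemSign xj).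
    by apply/(lpart_le_enc Sigma1); rewrite enc_sign_step; apply:
      refines_zero_outl.
  (* Signing j is forbidden only in type D, when x has no signed block and the cell of j is {j}. As
     y lies in the subposet, it signs some further i. *)
  have [c1 cx cy] : [/\ #|zeros x :|:
    cell x j| = 1, #|zeros x| != 1 & #|zeros y| != 1].
    move: Px Py Pw; rewrite !in_subposetE zeros_sign_step.
    by case: t => // -> ->; rewrite negbK => /eqP.
  have sj : j \in zeros x :|: cell x j by rewrite inE cell_root ?orbT.
  have /eqP/cards1P[i0 E0] := c1.
  have ji0 : j = i0 by apply/set1P; rewrite -E0.
  rewrite -{i0}ji0 in E0.
  have x0 : zeros x = set0.
    apply/eqP; rewrite -subset0; apply/subsetP => i xi.
    have : zeros x \subset [set j] by rewrite -E0 subsetUl.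
    by rewrite subset1 => /orP[/eqP E|/eqP <- //]; rewrite E cards1 in cx.
  have jy : j \in zeros y by rewrite inE Ey.
  have /subsetPn[i yi] : ~~ (zeros y \subset [set j]).
    rewrite subset1 negb_or; apply/andP; split.
      by apply: contra cy => /eqP ->; rewrite cards1.
    by apply/set0Pn; exists j.
  rewrite inE => ij.
  case Ei: (enc sigma x i) => [w|]; last first.
    by move: (in_set0 i); rewrite -x0 inE Ei.
  have xw := canon_root (cenc x) Ei.
  have wj : w.1 != j.
    apply: contra ij => /eqP wj; have : i \in zeros x :|: cell x j.
      by rewrite !inE Ei /= wj eqxx ?orbT.
    by rewrite E0 inE.
  have yw : enc sigma y w.1 = None.
    move: yi; rewrite inE le Ei /= /spread.
    by case: (enc sigma y w.1).
  have [ltwj|ltjw|E] := ltngtP w.1 j.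
  (* Both roots are signed in y, so either value of e would do. *)
  - by apply: (@mergeP w.1 j false) => //; rewrite Ey yw.
  - by apply: (@mergeP j w.1 false) => //; rewrite Ey yw.
  - by rewrite (ord_inj E) eqxx in wj.
have [yk /= lekj] := cenc _ _ _ Ey; rewrite /= in yk.
have kj : k != j.
  apply: contraNneq yj => kj; rewrite kj in Ey.
  by rewrite inE Ey (canon_self (cenc y) Ey).
apply: (@mergeP k j e) => //.
- by apply: (subsetP (refines_roots (cenc x) (cenc y) le)); rewrite inE yk.
- by rewrite ltn_neqAle lekj andbT.
- by rewrite Ey yk.
Qed.

(** A cover is elementary by [elementary_below]. Conversely an elementary step loses exactly one
    root, while every strict relation loses at least one, so nothing fits in between. *)
Lemma covers_inE x y :
  covers_in (@subposet t n Sigma sigma) (Some x) (Some y) <->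
  [/\ in_subposet x, in_subposet y & elementary x y].
Proof.
split=> [/and4P[Px Py lt /forallP nz]|[Px Py el]].
  split=> //; have [w [el Pw le]] := elementary_below Px Py lt.
  have [<- //|neq] := eqVneq w y.
  have := nz (Some w); rewrite -/(in_subposet w) Pw /= elementary_lt //=.
  rewrite lt_neqAle; case/negP; by apply/andP; split.
apply/and4P; split=> //; first exact: elementary_lt.
apply/forallP => -[w|]; last by apply/implyP => _; apply/negP => /andP[_ /ltW].
apply/implyP => _; apply/negP => /andP[/lt_lroots/proper_card xw
  /lt_lroots/proper_card wy].
by have := elementary_card el; lia.
Qed.
End Covers.

(** * Labels of elementary steps *)

Section Labels.
Variables (n : nat) (d : Order.disp_t) (Sigma : finOrderType d) (sigma : Sigma).
Hypothesis Sigma1 : [set: Sigma] = [set sigma].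
Implicit Types (x y : lpart n Sigma) (i j k : 'I_n) (z w : dbl n) (e : bool).

Lemma spread_fuse (F : {ffun 'I_n -> option (dbl n)}) j k e z :
  spread (fuse F j k e) z =
  if spread F z is Some w then
    if w.1 == k then Some (j, w.2 (+) e) else Some w else None.
Proof.
rewrite /spread ffunE; case: (F z.1) => [w|] //=; case: ifP => // _ /=.
by rewrite /twist /= addbAC.
Qed.

(** Both sets in [sign_label] are nonempty subsets of a one-element type. *)
Lemma sign_labelE x (s : Sigma) : sign_label x s = (1, 1).
Proof.
have E u : u = s by rewrite (SigmaE Sigma1 u) (SigmaE Sigma1 s).
have cardE (A : {set Sigma}) : s \in A -> #|A| = 1.
  by move=> As; apply/eqP/cards1P; exists s; apply/setP => u;
    rewrite inE (E u) eqxx.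
by rewrite /sign_label; case: ifP => xs;
  rewrite cardE // in_set ?xs ?in_set lexx.
Qed.

Lemma sign_step_label x j : j \in lroots sigma x ->
  lpart_label x (sign_step sigma x j) = (1, 1).
Proof.
move=> xj; rewrite /lpart_label; case: pickP => [s _|/(_ sigma)]; first exact:
  sign_labelE.
case/negP; rewrite properE; apply/andP; split.
  have /ltW : (Some x < Some (sign_step sigma x j) :> lposet n Sigma)%O.
    by apply/(elementary_lt Sigma1)/(ElemSign xj).
  by case/lpart_leP.
apply/subsetPn; exists (j, false); rewrite -(spread_encN Sigma1) spread_false.
  by rewrite enc_sign_step // ffunE (rootsE xj) /= eqxx.
by rewrite (rootsE xj).
Qed.

Lemma unsigned_normalized x R : unsigned x R -> normalized R ->
  exists2 i, i \in lroots sigma x & R = blk x (i, false).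
Proof.
case/andP=> xR /eqP sR /existsP[i /andP[/eqP Ei Ri]].
have RE := blkE xR Ri; exists i => //.
have : (i, false) \notin sblock x sigma.
  rewrite (in_sblock Sigma1) -RE; apply/negP => Rbi.
  have E : R = barset R by rewrite {1}(blkE xR Rbi) blk_bar -RE.
  by have := signedE xR; rewrite sR -E !eqxx.
rewrite -(spread_encN Sigma1) spread_false; case E: (enc sigma x i) =>
  [w|] // _.
move: (E); rewrite -spread_false => /(spread_encS Sigma1)[_];
  rewrite -RE -Ei => -[wi] _.
move: E; case: w wi => l b /= /ord_inj -> E.
by rewrite inE E (canon_self (enc_canonical Sigma1 x) E).
Qed.

Lemma root_block x i : i \in lroots sigma x ->
  [/\ unsigned x (blk x (i, false)), normalized (blk x (i, false))
    & rep (blk x (i, false)) = i.+1].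
Proof.
move=> xi; have := rootsE xi; rewrite -spread_false.
move=> /(spread_encS Sigma1)[Ri /= Ei Ni]; split=> //.
  rewrite /unsigned blk_block -[_ == None]negbK signedE ?blk_block //.
  apply: contra Ni => /eqP E; rewrite (in_sblock Sigma1) E.
  by rewrite in_barset barK mem_blk.
by apply/existsP; exists i; rewrite Ei eqxx.
Qed.

Lemma merge_step_block x j k e : j \in lroots sigma x ->
  k \in lroots sigma x -> j < k ->
  blk x (j, false) :|: blk x (k, e) = blk (merge_step sigma x j k e) (j, false).
Proof.
move=> xj xk ltjk; have jk : (j == k) = false.
  by apply/negP => /eqP E; rewrite E ltnn in ltjk.
apply/setP => z; rewrite !(blk_enc Sigma1) !inE enc_merge_step // !spread_fuse.
rewrite /spread /= !(rootsE xj) !(rootsE xk) /= jk -/(spread _ z).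
case: spread => [[l b]|] //=; rewrite !(inj_eq Some_inj) /twist /= !xpair_eqE.
case: (l =P k) => [->|/eqP lk]; last first.
  by rewrite [k == l]eq_sym (negPf lk) /= orbF (inj_eq Some_inj) xpair_eqE.
by rewrite jk (inj_eq Some_inj) xpair_eqE !eqxx; case: b; case: e.
Qed.

Lemma enc_merge_root x j k e i : j \in lroots sigma x -> k \in lroots sigma x ->
  j < k -> i \in lroots sigma x ->
  enc sigma (merge_step sigma x j k e) i =
  if i == k then Some (j, e) else Some (i, false).
Proof.
move=> xj xk ltjk xi; rewrite enc_merge_step // ffunE (rootsE xi) /=.
by case: eqP.
Qed.

(** Among the roots of x, the merge identifies only j and k, up to the bar given by e, so any pair
    found by [lpart_label] consists of their two blocks. *)
Lemma merge_step_label x j k e : j \in lroots sigma x ->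
  k \in lroots sigma x -> j < k ->
  lpart_label x (merge_step sigma x j k e) =
  if e then (2, j.+1) else (0, k.+1).
Proof.
move=> xj xk ltjk; set y := merge_step _ _ _ _ _; rewrite /lpart_label.
have jk : (j == k) = false by apply/negP => /eqP E; rewrite E ltnn in ltjk.
case: pickP => [s|_].
  rewrite (SigmaE Sigma1 s) => /proper_card.
  by rewrite !card_sblock // zeros_merge_step // ltnn.
have [uj nj rj] := root_block xj; have [uk nk rk] := root_block xk.
have neq : blk x (j, false) != blk x (k, false).
  apply/eqP => E; have : (k, false) \in blk x (j, false) by rewrite E mem_blk.
  rewrite -(spread_enc_eq Sigma1) !spread_false (rootsE xj) (rootsE xk).
  by rewrite (inj_eq Some_inj) xpair_eqE jk.
have same u v S : S \in blocks y -> u \in S -> v \in S ->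
    spread (enc sigma y) u = spread (enc sigma y) v.
  by move=> yS Su Sv; apply/eqP; rewrite (spread_enc_eq Sigma1) -(blkE yS Su).
case: pickP => [[R R'] /= /andP[/and5P[uR uR' nR nR' RR'] yRR']|noR].
  have [i xi RE] := unsigned_normalized uR nR.
  have [i' xi' RE'] := unsigned_normalized uR' nR'.
  have ii' : i <> i' by move=> E; case/eqP: RR'; rewrite RE RE' E.
  have : enc sigma y i = enc sigma y i'.
    rewrite -!spread_false; apply: same yRR' _ _;
      rewrite inE RE RE' mem_blk ?orbT //.
  have [[_ _ ri] [_ _ ri']] := (root_block xi, root_block xi').
  rewrite RE RE' ri ri' !enc_merge_root //.
  case: eqP => [ik|_]; case: eqP => [ik'|_].
  - by case: ii'; rewrite ik ik'.
  - by case=> <- ->; rewrite ik; congr (_, _); apply/maxn_idPl/ltnW.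
  - by case=> -> <-; rewrite ik'; congr (_, _); apply/maxn_idPr/ltnW.
  - by case.
(* The search for a coherent pair has failed, which it cannot do for a coherent merge. *)
have eT : e = true.
  case E: e => //; have := noR (blk x (j, false), blk x (k, false)).
  rewrite /= uj uk nj nk neq /=.
  have := merge_step_block e xj xk ltjk; rewrite {1}E => ->.
  by rewrite blk_block.
rewrite eT; case: pickP => [[R R'] /= /andP[/and5P[uR uR' nR nR' RR']
  yRR']|noR'].
  have [i xi RE] := unsigned_normalized uR nR.
  have [i' xi' RE'] := unsigned_normalized uR' nR'.
  have ii' : i <> i' by move=> E; case/eqP: RR'; rewrite RE RE' E.
  have : spread (enc sigma y) (i, false) = spread (enc sigma y) (bar (i',
    false)).
    by apply: same yRR' _ _; rewrite inE RE RE' ?in_barset ?barK mem_blk ?orbT.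
  have [[_ _ ri] [_ _ ri']] := (root_block xi, root_block xi').
  rewrite spread_bar !spread_false RE RE' ri ri' !enc_merge_root // eT.
  case: eqP => [ik|_]; case: eqP => [ik'|_].
  - by case: ii'; rewrite ik ik'.
  - by case=> <-; rewrite ik; congr (_, _); apply/minn_idPr/ltnW.
  - by case=> ->; rewrite ik'; congr (_, _); apply/minn_idPl/ltnW.
  - by [].
have := noR' (blk x (j, false), blk x (k, false)).
rewrite /= uj uk nj nk neq /= -blk_bar.
by rewrite -[bar (k, false)]/(k, true) merge_step_block // /y eT blk_block.
Qed.
End Labels.

(** * Counting decreasing chains *)

Section Chains.
Variables (T : finType) (r : rel T) (lam : T -> T -> label) (b : T).

(** The bound l on the first label carries the decreasing condition through the recursion. *)
Fixpoint chains k a (l : label) : seq (seq T) :=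
  if k is k'.+1 then
    [seq y :: p | y <- [seq y <- enum T | r a y && (lam a y <= l)%O],
                  p <- chains k' y (lam a y)]
  else if a == b then [:: [::]] else [::].

Lemma mem_chains k a l p : (p \in chains k a l) =
  [&& size p == k, path r a p, last a p == b
    & path (fun l l' : label => (l' <= l)%O) l (pairmap lam a p)].
Proof.
elim: k a l p => [|k IH] a l p /=.
  by case: p => [|y p] /=; case: eqP => //= _; rewrite ?inE ?andbT.
apply/allpairsPdep/idP => [[y [q [yE qE ->]]]|].
  move: yE qE; rewrite mem_filter IH => /andP[/andP[ay ll] _] qE /=.
  by rewrite eqSS ay ll.
case: p => [//|y q] /=; rewrite eqSS => /and4P[sq /andP[ay yq] lq /andP[ll pq]].
exists y, q; split=> //; first by rewrite mem_filter ay ll mem_enum.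
by rewrite IH sq yq lq.
Qed.

Lemma chains_uniq k a l : uniq (chains k a l).
Proof.
elim: k a l => [|k IH] a l /=; first by case: ifP.
apply: allpairs_uniq_dep => [|y _|]; [exact/filter_uniq/enum_uniq|exact: IH|].
by move=> [y p] [y' p'] _ _ /= [-> ->].
Qed.

Definition nchains k a l := size (chains k a l).

Lemma nchains0 a l : nchains 0 a l = (a == b).
Proof. by rewrite /nchains /=; case: ifP. Qed.

Lemma nchainsS k a l : nchains k.+1 a l =
  \sum_(y | r a y && (lam a y <= l)%O) nchains k y (lam a y).
Proof.
by rewrite /nchains /= size_allpairs_dep sumnE big_map big_filter big_enum_cond.
Qed.
End Chains.

(** Fixing the length k and bounding the first label by l loses no chain under the two
    hypotheses. *)
Lemma nb_dec_max_chainsE (d : Order.disp_t) (T : finPOrderType d) (P : pred T)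
    (lam : T -> T -> label) (a b : T) k l :
    (forall p, max_chain P a b p -> size p = k) ->
    (forall y, covers_in P a y -> (lam a y <= l)%O) ->
  nb_dec_max_chains P lam a b = nchains (covers_in P) lam b k a l.
Proof.
move=> sizeP headP; rewrite /nb_dec_max_chains cardE /nchains.
rewrite -(size_map (fun p : {bseq #|T| of T} => p : seq T)); apply/perm_size.
apply: uniq_perm; rewrite ?chains_uniq ?map_inj_uniq ?enum_uniq //.
  exact: val_inj.
move=> p; rewrite mem_chains; apply/mapP/and4P => [[q]|[/eqP sp pp lp dp]].
  rewrite mem_enum inE => /andP[mc dc] -> /=; have /andP[pq lq] := mc.
  split=> //; first by rewrite sizeP.
  move: pq dc; rewrite /decreasing; case: (q : seq T) => [|y s] //= /andP[ay _].
  by rewrite headP.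
have mc : max_chain P a b p by rewrite /max_chain pp.
exists (Bseq (max_chain_size mc)) => //; rewrite mem_enum inE mc /=.
exact: path_sorted dp.
Qed.

Lemma le_label (a a' c c' : nat) : ((a, c) <= (a', c') :> label)%O =
  (a < a') || (a == a') && (c <= c').
Proof. by rewrite lexi_pair !leEnat; case: ltngtP. Qed.

Lemma le_label_pred (l : label) (a c : nat) :
  (l <= (a, c.+1))%O && (l != (a, c.+1)) = (l <= (a, c))%O.
Proof. by case: l => a' c'; rewrite !le_label xpair_eqE; lia. Qed.

(** In type D the first block to be signed must be a non-singleton, and the others follow in any
    order. *)
Definition finish (t : root_type) (a b : nat) : nat :=
  if t is TypeD then a * (a + b - 1)`! else (a + b)`!.

(** * Recursions for the number of decreasing completions *)

Section Count.
Variables (n : nat) (d : Order.disp_t) (Sigma : finOrderType d) (sigma : Sigma).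
Hypothesis Sigma1 : [set: Sigma] = [set sigma].
Hypothesis n_gt0 : 0 < n.
Variable t : root_type.
Implicit Types (x : lpart n Sigma) (y : lposet n Sigma) (i j k : 'I_n) (e :
  bool).

Local Notation top := (lpartT n_gt0 sigma).
Local Notation cov := (covers_in (@subposet t n Sigma sigma)).

Definition completions (m : nat) x (l : label) : nat :=
  nchains cov (@lambda n d Sigma) (Some top) m (Some x) l.

Lemma lroots_eq0 x : (lroots sigma x == set0) = (x == top).
Proof.
have topN i : enc sigma top i = None.
  apply/eqP; rewrite -spread_false (spread_encN Sigma1).
  have /sgn_sblock -> : sgn top setT = Some sigma by rewrite /sgn /= ffunE eqxx.
  by rewrite inE.
apply/eqP/eqP => [x0|->]; last by apply/setP => i; rewrite !inE topN.
apply: (enc_inj Sigma1); apply/ffunP => i; rewrite [RHS]topN.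
case E: (enc _ _ i) => [w|] //.
by have := canon_root (enc_canonical Sigma1 x) E; rewrite [roots _]x0 inE.
Qed.

Lemma cov_Some x (y : lpart n Sigma) : cov (Some x) (Some y) <->
  [/\ in_subposet sigma t x, in_subposet sigma t y & elementary sigma x y].
Proof. exact: covers_inE. Qed.

Lemma cov_None y : cov None y = false.
Proof.
apply/negP => /and4P[_ _ lt _]; have := ltW lt.
by case: y lt => [//|]; rewrite ltxx.
Qed.

Lemma nchains_None (k : nat) l :
  nchains cov (@lambda n d Sigma) (Some top) k None l = 0.
Proof.
case: k => [|k]; first by rewrite nchains0.
by rewrite nchainsS big1 // => y; rewrite cov_None.
Qed.

(** Below a coherent label only coherent covers may follow, and each of them leaves the smaller root
    in place, whereas [top] has no root. *)
Lemma completions_coherent (k : nat) x c : lroots sigma x != set0 ->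
  completions k x (0, c) = 0.
Proof.
elim: k x c => [|k IH] x c x0.
  rewrite /completions nchains0; apply/eqP; rewrite eqb0; apply: contra x0.
  by rewrite lroots_eq0 => /eqP[->].
rewrite /completions nchainsS big1 // => -[y|] /andP[];
  last by rewrite nchains_None.
case/cov_Some=> Px Py [j xj ->|j j' e xj xj' ltj ->] /=.
  by rewrite sign_step_label // le_label.
rewrite merge_step_label //; case: e => [|_]; first by rewrite le_label.
apply: IH; apply/set0Pn; exists j; rewrite lroots_merge_step //.
by rewrite in_setD1 xj neq_ltn ltj.
Qed.


Lemma sum_cov_sign x (G : lposet n Sigma -> nat) : in_subposet sigma t x ->
  \sum_(y | cov (Some x) y && (lambda (Some x) y == (1, 1))) G y =
  \sum_(j in lroots sigma x | in_subposet sigma t (sign_step sigma x j))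
     G (Some (sign_step sigma x j)).
Proof.
move=> Px.
pose A := [set j in lroots sigma x | in_subposet sigma t (sign_step sigma x j)].
transitivity (\sum_(j in A) G (Some (sign_step sigma x j))); last first.
  by apply: eq_bigl => j; apply/setIdP/andP.
rewrite -(big_imset G (h := fun j => Some (sign_step sigma x j))) /=;
  last first.
  move=> j j' /setIdP[xj _] _ [E].
  have : lroots sigma x :\ j = lroots sigma x :\ j'.
    by rewrite -!(lroots_sign_step Sigma1) E.
  by move/setP/(_ j); rewrite setD11 in_setD1 xj andbT; case: eqP.
apply: eq_bigl => y; apply/andP/imsetP => [[]|[j]].
  case: y => [y|] // /cov_Some[_ Py [j xj E|j k e xj xk ltjk E]].
    by exists j; rewrite -?E //; apply/setIdP; rewrite -E.
  by rewrite E /= merge_step_label //; case: e {E}.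
case/setIdP=> xj Pj ->; split; last by rewrite /= sign_step_label.
by apply/cov_Some; split=> //; apply: ElemSign xj _.
Qed.

Lemma in_subposet_merge_step x j k e : j \in lroots sigma x -> j < k ->
  in_subposet sigma t (merge_step sigma x j k e) = in_subposet sigma t x.
Proof. by move=> xj ltjk; rewrite !(in_subposetE Sigma1) zeros_merge_step. Qed.

Lemma sum_cov_noncoherent x j (G : lposet n Sigma -> nat) :
    in_subposet sigma t x -> j \in lroots sigma x ->
  \sum_(y | cov (Some x) y && (lambda (Some x) y == (2, j.+1))) G y =
  \sum_(k in lroots sigma x | j < k) G (Some (merge_step sigma x j k true)).
Proof.
move=> Px xj; pose A := [set k in lroots sigma x | j < k].
transitivity (\sum_(k in A) G (Some (merge_step sigma x j k true))); last first.
  by apply: eq_bigl => k; apply/setIdP/andP.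
rewrite -(big_imset G (h := fun k => Some (merge_step sigma x j k true))) /=;
  last first.
  move=> k k' /setIdP[xk jk] /setIdP[xk' jk'] [E].
  have : lroots sigma x :\ k = lroots sigma x :\ k'.
    by rewrite -(lroots_merge_step Sigma1 true xj jk) E lroots_merge_step.
  by move/setP/(_ k); rewrite setD11 in_setD1 xk andbT; case: eqP.
apply: eq_bigl => y; apply/andP/imsetP => [[]|[k]].
  case: y => [y|] // /cov_Some[_ Py [i xi E|i k e xi xk ltik E]].
    by rewrite E /= sign_step_label.
  rewrite E /= merge_step_label //; case: e E => // E /eqP[/ord_inj ij].
  by rewrite ij in E ltik; exists k; [apply/setIdP|rewrite ij].
case/setIdP=> xk jk ->; split; last by rewrite /= merge_step_label.
by apply/cov_Some; split; rewrite ?in_subposet_merge_step //; apply: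
  ElemMerge xj xk jk _.
Qed.

(** Either the first label is [(2, j.+1)], which fixes the smaller root j and leaves the larger one
    free, or it is at most [(2, j)]. *)
Lemma completions_noncoherent m x j : in_subposet sigma t x ->
  j \in lroots sigma x ->
  completions m.+1 x (2, j.+1) =
  \sum_(k in lroots sigma x | j < k)
     completions m (merge_step sigma x j k true) (2, j.+1) +
  completions m.+1 x (2, nat_of_ord j).
Proof.
move=> Px xj; rewrite /completions !nchainsS.
rewrite (bigID (fun y => lambda (Some x) y == (2, j.+1))) /=; congr addn.
  rewrite -(sum_cov_noncoherent
    (fun y => nchains cov (@lambda n d Sigma) (Some top) m y (2, j.+1))) //.
  apply: eq_big => y.
    by rewrite -andbA; congr andb; case: eqP => [->|]; rewrite ?lexx ?andbF.
  by case/andP=> _ /eqP ->.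
apply: eq_bigl => y; rewrite -andbA; congr andb.
exact: le_label_pred.
Qed.

Lemma completions_noncoherent0 m x :
  completions m x (2, 0) = completions m x (1, 1).
Proof.
case: m => [|m]; rewrite /completions ?nchains0 // !nchainsS.
(* The label [(1, 2)] of an edge to the maximum lies between the two bounds, but such an edge never
   leads to [top]. *)
rewrite big_mkcond [RHS]big_mkcond /=; apply: eq_bigr => -[y|] _; last first.
  by rewrite nchains_None !if_same.
case: (boolP (cov (Some x) (Some y))) =>
  //= /cov_Some[_ _ [j xj ->|j k e xj xk ltjk ->]].
  by rewrite /= sign_step_label // !le_label.
by rewrite /= merge_step_label //; case: e; rewrite !le_label.
Qed.

(** Labels strictly below [(1, 1)] are coherent and admit no completion. *)
Lemma completions_sign m x : in_subposet sigma t x ->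
  completions m.+1 x (1, 1) =
  \sum_(j in lroots sigma x | in_subposet sigma t (sign_step sigma x j))
     completions m (sign_step sigma x j) (1, 1).
Proof.
move=> Px; rewrite /completions nchainsS.
rewrite (bigID (fun y => lambda (Some x) y == (1, 1))) /= [X in _ + X]big1
  ?addn0.
  rewrite -(sum_cov_sign (fun y => nchains cov (@lambda n d Sigma) (Some top)
    m y (1, 1))) //.
  apply: eq_big => y.
    by rewrite -andbA; congr andb; case: eqP => [->|]; rewrite ?lexx ?andbF.
  by case/andP=> _ /eqP ->.
move=> [y|] /andP[/andP[]]; last by rewrite nchains_None.
case/cov_Some=> _ _ [j xj ->|j k e xj xk ltjk ->].
  by rewrite /= sign_step_label // eqxx.
rewrite /= merge_step_label //; case: e; first by rewrite le_label.
move=> _ _; apply: completions_coherent; apply/set0Pn; exists j.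
rewrite lroots_merge_step // in_setD1 xj andbT.
by rewrite neq_ltn ltjk.
Qed.

Lemma card_lroots_sign x j : j \in lroots sigma x ->
  #|lroots sigma x| = #|lroots sigma (sign_step sigma x j)|.+1.
Proof. by move=> xj; rewrite lroots_sign_step // (cardsD1 j) xj. Qed.

Lemma card_lroots_merge x j k e : j \in lroots sigma x ->
  k \in lroots sigma x -> j < k ->
  #|lroots sigma x| = #|lroots sigma (merge_step sigma x j k e)|.+1.
Proof. by move=> xj xk ltjk; rewrite lroots_merge_step // (cardsD1 k) xk. Qed.

(** The roots can be signed in any order: in type D the signed block is already nonempty, hence has
    at least two underlying integers and only grows. *)
Lemma completions_sign_fact x : in_subposet sigma t x ->
  (if t is TypeD then zeros sigma x != set0 else true) ->
  completions #|lroots sigma x| x (1, 1) = #|lroots sigma x|`!.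
Proof.
move rE: #|lroots sigma x| => r; elim: r x rE => [|r IH] x rE Px x0.
  rewrite /completions nchains0 fact0; apply/eqP; rewrite eqb1.
  by have := cards_eq0 (lroots sigma x);
    rewrite rE lroots_eq0 eqxx => /esym/eqP ->.
rewrite completions_sign // (eq_bigr (fun=> r`!)) => [|j /andP[xj Pj]];
  last first.
  have := card_lroots_sign xj; rewrite rE => -[rj]; apply: IH => //.
  case: t x0 => //; rewrite zeros_sign_step // => /set0Pn[i xi].
  by apply/set0Pn; exists i; rewrite inE xi.
rewrite sum_nat_const factS -rE; congr muln; apply: eq_card => j.
rewrite unfold_in /=; case xj: (j \in lroots sigma x) => //=.
move: Px x0; rewrite !(in_subposetE Sigma1) zeros_sign_step //; case:
  t => // x1 x0.
have := subset_leq_card (subsetUl (zeros sigma x) (cell sigma x j)).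
by rewrite -cards_eq0 in x0; lia.
Qed.

Definition nonsingle_from x m :=
  #|[set j in lroots sigma x | (m <= j) && (1 < #|cell sigma x j|)]|.
Definition single_from x m :=
  #|[set j in lroots sigma x | (m <= j) && (#|cell sigma x j| == 1)]|.

Lemma cell_gt0 x j : j \in lroots sigma x -> 0 < #|cell sigma x j|.
Proof. by move/(cell_root); rewrite card_gt0 => xj; apply/set0Pn; exists j. Qed.

Lemma cell_gt1 x j : j \in lroots sigma x ->
  (1 < #|cell sigma x j|) = (#|cell sigma x j| != 1).
Proof. by move=> xj; rewrite ltn_neqAle eq_sym cell_gt0 ?andbT. Qed.

Lemma card_lroots_from0 x :
  #|lroots sigma x| = nonsingle_from x 0 + single_from x 0.
Proof.
rewrite -(cardsID [set j | 1 < #|cell sigma x j|]); congr addn; apply: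
  eq_card => j.
  by apply/setIP/setIdP => -[xj]; rewrite in_set.
by apply/setDP/setIdP => -[xj]; have := cell_gt0 xj; rewrite in_set;
  split=> //; lia.
Qed.

(** In type D without a signed block, the first sign step needs a non-singleton cell; afterwards
    [completions_sign_fact] applies. *)
Lemma completions_from0 x : zeros sigma x = set0 ->
  completions #|lroots sigma x| x (2, 0) =
  finish t (nonsingle_from x 0) (single_from x 0).
Proof.
move=> x0; have Px :
  in_subposet sigma t x by rewrite (in_subposetE Sigma1) x0 cards0; case: t.
rewrite completions_noncoherent0 /finish -card_lroots_from0.
have [tD|tN] := boolP (if t is TypeD then true else false); last first.
  by rewrite completions_sign_fact //; case: t tN.
have -> : (if t is TypeD then nonsingle_from x 0 * (#|lroots sigma x| - 1)`!
    else #|lroots sigma x|`!) = nonsingle_from x 0 * (#|lroots sigma x|.-1)`!.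
  by rewrite subn1; case: t tD.
have [r rE] : exists r, #|lroots sigma x| = r.+1.
  suff : 0 < #|lroots sigma x| by case: #|_| => // r; exists r.
  rewrite card_gt0; apply/set0Pn; pose i0 := Ordinal n_gt0.
  case E: (enc sigma x i0) => [w|].
    by exists w.1; apply: canon_root E; apply: enc_canonical Sigma1 x.
  by have := in_set0 i0; rewrite -x0 inE E.
rewrite rE completions_sign // (eq_bigr (fun=> r`!)) => [|j /andP[xj Pj]];
  last first.
  have := card_lroots_sign xj; rewrite rE => -[->]; apply:
    completions_sign_fact => //.
  case: t tD => // _; apply/set0Pn; exists j.
  by rewrite zeros_sign_step // in_setU cell_root ?orbT.
rewrite sum_nat_const; congr muln; apply: eq_card => j.
rewrite unfold_in /= (in_subposetE Sigma1) zeros_sign_step // x0 set0U.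
by apply/andP/setIdP => -[xj cj]; split=> //; move: cj;
  rewrite cell_gt1 //=; case: t tD.
Qed.

(** The state before stage m: the integers 1, ..., m are still singletons. *)
Definition low x m := forall i, i < m ->
  i \in lroots sigma x /\ #|cell sigma x i| = 1.

Lemma nonsingle_fromS x j : j \in lroots sigma x ->
  nonsingle_from x j = (1 < #|cell sigma x j|) + nonsingle_from x j.+1.
Proof.
move=> xj; rewrite /nonsingle_from [LHS](cardsD1 j); congr (nat_of_bool _ + _).
  by apply/setIdP/idP => [[_ /andP[]]|cj]; rewrite ?leqnn.
apply: eq_card => i;
  apply/setD1P/setIdP => [[ij /setIdP[xi /andP[ji ci]]]|[xi /andP[ji ci]]].
  by split=> //; rewrite ci andbT ltn_neqAle ji andbT eq_sym.
by split; [rewrite neq_ltn ji orbT|apply/setIdP; rewrite ci (ltnW ji)].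
Qed.

Lemma single_fromS x j : j \in lroots sigma x ->
  single_from x j = (#|cell sigma x j| == 1) + single_from x j.+1.
Proof.
move=> xj; rewrite /single_from [LHS](cardsD1 j); congr (nat_of_bool _ + _).
  by apply/setIdP/idP => [[_ /andP[]]|cj]; rewrite ?leqnn.
apply: eq_card => i;
  apply/setD1P/setIdP => [[ij /setIdP[xi /andP[ji ci]]]|[xi /andP[ji ci]]].
  by split=> //; rewrite ci andbT ltn_neqAle ji andbT eq_sym.
by split; [rewrite neq_ltn ji orbT|apply/setIdP; rewrite ci (ltnW ji)].
Qed.

(** Among the roots above j, the merge only removes k; the cells of the others do not change. *)
Lemma card_from_merge x j k e (p : pred nat) : j \in lroots sigma x ->
    k \in lroots sigma x -> j < k ->
  #|[set i in lroots sigma x | (j < i) && p #|cell sigma x i|]| =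
  p #|cell sigma x k| +
  #|[set i in lroots sigma (merge_step sigma x j k e) |
       (j < i) && p #|cell sigma (merge_step sigma x j k e) i|]|.
Proof.
move=> xj xk ltjk; rewrite [LHS](cardsD1 k); congr (nat_of_bool _ + _).
  by apply/setIdP/idP => [[_ /andP[]]|]; rewrite ?ltjk.
apply: eq_card => i.
apply/setD1P/setIdP => [[ik /setIdP[xi /andP[ji ci]]]|[]];
  rewrite lroots_merge_step // cell_merge_step //.
  by split; [apply/setD1P|rewrite ji (negPf ik) ifN // neq_ltn ji orbT].
case/setD1P=> ik xi /andP[ji].
rewrite (negPf ik) ifN => [ci|]; last by rewrite neq_ltn ji orbT.
by split=> //; apply/setIdP; rewrite ji.
Qed.

Lemma low_merge x j k e : j \in lroots sigma x -> j < k -> low x j ->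
  low (merge_step sigma x j k e) j.
Proof.
move=> xj ltjk lx i ij; have [xi ci] := lx i ij.
rewrite lroots_merge_step // cell_merge_step //.
have ik : i != k by rewrite neq_ltn (ltn_trans ij ltjk).
by rewrite (negPf ik) ifN ?neq_ltn ?ij //; split=> //; apply/setD1P.
Qed.

Local Open Scope ring_scope.

Lemma sum_merge x j (phi : nat -> nat -> int) : j \in lroots sigma x ->
  \sum_(k in lroots sigma x | (j < k)%N)
     phi (nonsingle_from (merge_step sigma x j k true) j.+1)
         (single_from (merge_step sigma x j k true) j.+1) =
  (nonsingle_from x j.+1)%:R *
    phi (nonsingle_from x j.+1).-1 (single_from x j.+1) +
  (single_from x j.+1)%:R *
    phi (nonsingle_from x j.+1) (single_from x j.+1).-1.
Proof.
move=> xj; rewrite (bigID (fun k => (1 < #|cell sigma x k|)%N)) /=;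
  congr (_ + _).
  rewrite (eq_bigr (fun=> phi (nonsingle_from x j.+1).-1 (single_from x j.+1))).
    rewrite big_const iter_addr_0 mulr_natl; congr (_ *+ _).
    apply: eq_card => k; rewrite unfold_in /= -andbA.
    by apply/andP/setIdP.
  move=> k /andP[/andP[xk jk] ck].
  rewrite [in RHS]/nonsingle_from (card_from_merge true (leq 2) xj xk jk).
  rewrite [in RHS]/single_from (card_from_merge true (pred1 1%N) xj xk jk) /=.
  by rewrite ck gtn_eqF.
rewrite (eq_bigr (fun=> phi (nonsingle_from x j.+1) (single_from x j.+1).-1)).
  rewrite big_const iter_addr_0 mulr_natl; congr (_ *+ _).
  apply: eq_card => k; rewrite unfold_in /= -andbA.
  by apply/andP/setIdP => -[xk /andP[jk ck]]; split=> //; rewrite jk /=;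
    move: ck; rewrite cell_gt1 // negbK.
move=> k /andP[/andP[xk jk] ck].
rewrite [in RHS]/nonsingle_from (card_from_merge true (leq 2) xj xk jk).
rewrite [in RHS]/single_from (card_from_merge true (pred1 1%N) xj xk jk) /=.
by move: ck; rewrite cell_gt1 // negbK => /eqP ->.
Qed.

Definition finishZ a b : int := (finish t a b)%:R.

(** Induction on the stage. While the root of the stage absorbs larger roots, the counts follow the
    recursion of [absorb]; its start as a singleton gives [adjoin]. *)
Lemma completions_from m x : (m <= n)%N -> zeros sigma x = set0 -> low x m ->
  (completions #|lroots sigma x| x (2%N, m))%:R =
  iter m adjoin finishZ (nonsingle_from x m) (single_from x m) :> int.
Proof.
elim: m x => [|m IH] x lemn x0 lx; first by rewrite completions_from0.
have lxm : low x m by move=> i im; apply: lx; apply: leqW.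
(* Ordinals start at 0, so j stands for the integer m + 1. *)
pose j := Ordinal lemn; have jE : j = m :> nat by [].
have [xj cj] := lx j (leqnn _).
have in0 (y : lpart n Sigma) : zeros sigma y = set0 -> in_subposet sigma t y.
  by move=> y0; rewrite (in_subposetE Sigma1) y0 cards0; case: t.
(* Either j absorbs one more root, or the stage ends and the bound drops to [(2, m)]. *)
have step (y : lpart n Sigma) : zeros sigma y = set0 ->
  j \in lroots sigma y -> low y m ->
    (completions #|lroots sigma y| y (2%N, m.+1))%:R =
    \sum_(k in lroots sigma y | (j < k)%N)
      (completions #|lroots sigma (merge_step sigma y j k true)|
         (merge_step sigma y j k true) (2%N, m.+1))%:R +
    iter m adjoin finishZ (nonsingle_from y m) (single_from y m) :> int.
  move=> y0 yj ly; rewrite -IH ?(ltnW lemn) //.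
  have [r rE] : exists r, #|lroots sigma y| = r.+1.
    by exists #|lroots sigma y :\ j|; rewrite (cardsD1 j) yj.
  rewrite rE -jE completions_noncoherent ?in0 // natrD natr_sum; congr (_ + _).
  apply: eq_bigr => k /andP[yk jk].
  by have := card_lroots_merge true yj yk jk; rewrite rE => -[->].
have merged (y : lpart n Sigma) k : zeros sigma y = set0 ->
  j \in lroots sigma y -> low y m ->
    k \in lroots sigma y -> (j < k)%N ->
    let y' := merge_step sigma y j k true in
    [/\ zeros sigma y' = set0, j \in lroots sigma y', low y' m
      & (1 < #|cell sigma y' j|)%N].
  move=> y0 yj ly yk jk; split.
  - by rewrite zeros_merge_step.
  - by rewrite lroots_merge_step // in_setD1 yj neq_ltn jk.
  - exact: (low_merge (j := j)).
  - rewrite cell_merge_step // eqxx.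
    apply: (@leq_trans #|[set j; k]|).
      by rewrite cards2 neq_ltn jk.
    apply: subset_leq_card; rewrite subUset !sub1set !in_setU.
    by rewrite (cell_root yj) (cell_root yk) orbT.
have absorbed (y : lpart n Sigma) : zeros sigma y = set0 ->
  j \in lroots sigma y -> low y m ->
    (1 < #|cell sigma y j|)%N ->
    (completions #|lroots sigma y| y (2%N, m.+1))%:R =
    absorb (iter m adjoin finishZ) (nonsingle_from y m.+1) (single_from y m.+1)
    :> int.
  have [r] := ubnP #|lroots sigma y|; elim: r y => // r IHr y ltr y0 yj ly cyj.
  rewrite step // absorbE; congr (_ + _).
    rewrite -jE -(sum_merge (absorb (iter m adjoin finishZ)) yj).
    apply: eq_bigr => k /andP[yk jk].
    have [y'0 y'j ly' cy'] := merged y k y0 yj ly yk jk.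
    by apply: IHr => //; have := card_lroots_merge true yj yk jk; lia.
  (* When the stage ends, j itself is counted, here as a non-singleton. *)
  rewrite -jE nonsingle_fromS // single_fromS // cyj gtn_eqF //.
rewrite step // iterS /adjoin; congr (_ + _).
  rewrite -jE -(sum_merge (absorb (iter m adjoin finishZ)) xj).
  apply: eq_bigr => k /andP[xk jk].
  have [y'0 y'j ly' cy'] := merged x k x0 xj lxm xk jk.
  exact: absorbed.
by rewrite -jE nonsingle_fromS // single_fromS // cj.
Qed.

End Count.

(** * Counting from the partition into singletons *)

Section Total.
Variables (n : nat) (d : Order.disp_t) (Sigma : finOrderType d) (sigma : Sigma).
Hypothesis Sigma1 : [set: Sigma] = [set sigma].
Hypothesis n_gt0 : 0 < n.
Variable t : root_type.
Implicit Types (x : lpart n Sigma) (y : lposet n Sigma) (i j k : 'I_n).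

(** Every step removes one root, and [lpartT] is the only partition without roots. *)
Lemma size_max_chain x p :
  max_chain (@subposet t n Sigma sigma) (Some x) (Some (lpartT n_gt0 sigma)) p
    ->
  size p = #|lroots sigma x|.
Proof.
elim: p x => [|y p IH] x /andP[/=].
  by move=> _ /eqP[/eqP]; rewrite -(lroots_eq0 Sigma1) => /eqP ->;
    rewrite cards0.
case: y => [y|]; last by case: p {IH} => //= y p; rewrite cov_None andbF.
case/andP=> /(cov_Some Sigma1)[_ _ /(elementary_card Sigma1) ->] pp lp.
by rewrite (IH y) // /max_chain pp.
Qed.

Lemma lambda_le x y : covers_in (@subposet t n Sigma sigma) (Some x) y ->
  (lambda (Some x) y <= (2, n))%O.
Proof.
case: y => [y|_]; last by rewrite le_label.
case/(cov_Some Sigma1)=> _ _ [j xj ->|j k e xj xk ltjk ->].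
  by rewrite /= sign_step_label // le_label.
by rewrite /= merge_step_label //; case: e; rewrite le_label //= ltn_ord.
Qed.

Lemma enc_lpart0 i : enc sigma (lpart0 n Sigma) i = Some (i, false).
Proof.
have blk0 z : blk (lpart0 n Sigma) z = [set z].
  by apply/esym/blkE; rewrite ?set11 //; apply: imset_f.
rewrite -spread_false; case E: spread => [w|].
  by have [] := spread_encS Sigma1 E; rewrite blk0 inE => /eqP ->.
move/eqP: E; rewrite (spread_encN Sigma1) (in_sblock Sigma1) blk0 inE.
by rewrite bar_neq.
Qed.

Lemma lroots_lpart0 : lroots sigma (lpart0 n Sigma) = setT.
Proof. by apply/setP => i; rewrite !inE enc_lpart0 eqxx. Qed.

Lemma cell_lpart0 j : cell sigma (lpart0 n Sigma) j = [set j].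
Proof. by apply/setP => i; rewrite !inE enc_lpart0 /= (inj_eq Some_inj). Qed.

(** Start at stage n, where every block is a singleton and no root exceeds n, so both counts are
    0. *)
Lemma nb_dec_lpart0 :
  (nb_dec_max_chains (subposet t sigma) (@lambda n d Sigma)
     (Some (lpart0 n Sigma)) (Some (lpartT n_gt0 sigma)))%:R%R =
  inserts 0 n (finishZ t) 0 0.
Proof.
rewrite (nb_dec_max_chainsE (@size_max_chain _) (@lambda_le _)).
rewrite -[nchains _ _ _ _ _ _]/(completions sigma n_gt0 t _ _ _).
rewrite (completions_from Sigma1) //.
- rewrite -iter_adjoin00; congr (iter _ _ _ _ _); apply: eq_card0 => i;
    by apply/setIdP => -[_]; rewrite leqNgt ltn_ord.
- by apply/setP => i; rewrite !inE enc_lpart0.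
- by move=> i _; rewrite lroots_lpart0 cell_lpart0 cards1 in_setT.
Qed.
End Total.

Lemma coefficient_finish t n (P : {set {set 'I_n}}) :
  partition P [set: 'I_n] ->
    coefficient t P = finish t (nonsingle P) (single P).
Proof.
move=> PT; have cP : #|P| = nonsingle P + single P.
  rewrite -(cardsID [set A : {set 'I_n} | 1 < #|A|]); congr addn; apply:
    eq_card => A.
    by rewrite !inE.
  rewrite !inE; case PA: (A \in P); rewrite ?andbF //=.
  have : 0 < #|A|.
    rewrite card_gt0; have /and3P[_ _ P0] := PT.
    by apply: contraNneq P0 => <-.
  by case: #|A| => [|[]].
by rewrite /coefficient /finish -cP; case: t.
Qed.

Theorem theorem5p3 (d : Order.disp_t) (Sigma : finOrderType d) (sigma : Sigma)
    (Sigma_singleton : [set: Sigma] = [set sigma])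
    (n : nat) (n_gt0 : 0 < n) (t : root_type) :
  nb_dec_max_chains (subposet t sigma) (@lambda n d Sigma)
    (Some (lpart0 n Sigma)) (Some (lpartT n_gt0 sigma)) =
  \sum_(pi : {set {set 'I_n}} | partition pi [set: 'I_n])
     coefficient t pi *
     \prod_(A in pi) dfact ((2 * #|A|)%N%:Z - 3)%R.
Proof.
(* The comparison takes place in [int], where the coefficients of [insert] live. *)
apply/eqP; rewrite -eqz_nat; apply/eqP.
rewrite -[LHS]natz nb_dec_lpart0 // -{1}(card_ord n) -cardsT -sum_treeE.
rewrite -[RHS]natz natr_sum; apply: eq_bigr => P PT.
by rewrite natrM natr_prod (coefficient_finish t PT) /tree_weight;
  congr (_ * _)%R; apply: eq_bigr => A _; rewrite natz.
Qed.
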